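(* There is an absolute constant $c>0$ such that the following holds. Let $p=p(n)$ be a sequence with $6/n \le p(n)<1$ for all $n$ and $p(n)\log n \to 0$ as $n\to\infty$, and let $G\sim D(n,p)$. Then, with probability $1-o(1)$ as $n\to\infty$, $$|\mathrm{MEC}(G)| \ge 2^{\,c\, p^{-1}/\log^2(p^{-1})}.$$ In particular, for all sufficiently large $n$, $\mathbb{E}[|\mathrm{MEC}(G)|] \ge 2^{\,c\, p^{-1}/\log^2(p^{-1})}$.
   Context: For $0<p<1$, $D(n,p)$ is the probability distribution on directed acyclic graphs (DAGs) with vertex set $\{1,\dots,n\}$ (no self-loops) that assigns each DAG with $e$ edges probability proportional to $(p/(1-p))^e$; equivalently, include each of the $n(n-1)$ possible directed edges independently with probability $p$ and condition on acyclicity. Paths and d-separation: a path from $a$ to $b$ in a (mixed) graph is a sequence $v_1,e_1,v_2,e_2,\dots,e_{k-1},v_k$ with $v_1=a\neq b=v_k$ (vertices may repeat), where each $e_j$ is an edge (directed in either direction, or bidirected $\leftrightarrow$) between $v_j$ and $v_{j+1}$. An internal vertex $v_j$ ($1<j<k$) is a collider on the path if both $e_{j-1}$ and $e_j$ have an arrowhead at $v_j$ (i.e. each is either a directed edge pointing into $v_j$ or a bidirected edge). A vertex $x$ is a descendant of $v$ if $x=v$ or there is a directed path $v\to\cdots\to x$. Given $Z\subseteq V\setminus\{a,b\}$, a path is active given $Z$ if every internal non-collider is not in $Z$ and every collider is in $Z$ or has a descendant in $Z$. $a,b$ are d-connected given $Z$ if some path between them is active given $Z$, otherwise d-separated. Two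 graphs on the same vertex set are Markov equivalent if they have exactly the same d-separation statements (for all $a,b,Z$). $\mathrm{MEC}(G)$, the Markov equivalence class of $G$, is the set of all graphs of the same model class (here DAGs) on the same vertex set that are Markov equivalent to $G$. $\log$ is the natural logarithm. *)

(* Defs.v *)
From HB Require Import structures.
From mathcomp Require Import all_boot all_order all_algebra.
From mathcomp Require Import all_classical all_reals all_analysis.
Set Implicit Arguments. Unset Strict Implicit. Unset Printing Implicit Defensive.
Import Order.TTheory GRing.Theory Num.Theory.
Local Open Scope ring_scope.

Definition digraph (n : nat) := {set 'I_n * 'I_n}.

Definition edge_rel n (E : digraph n) : rel 'I_n := fun u v => (u, v) \in E.

(* Descendant: x = v or a directed path v -> ... -> x  (connect is reflexive). *)
Definition descendant n (E : digraph n) (v x : 'I_n) : bool :=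
  connect (edge_rel E) v x.

(* DAG: no edge u -> v such that u is reachable from v (this excludes
   self-loops and directed cycles). *)
Definition is_dag n (E : digraph n) : bool :=
  [forall u, forall v, ((u, v) \in E) ==> ~~ connect (edge_rel E) v u].

(* A path from a is given by its start vertex a and a sequence of steps
   (d, v): the next vertex is v and the edge between the previous vertex w
   and v is w -> v if d = true, and v -> w if d = false.
   Vertices may repeat. *)
Fixpoint walk_ok n (E : digraph n) (w : 'I_n) (s : seq (bool * 'I_n)) : bool :=
  match s with
  | [::] => true
  | (d, v) :: s' => (if d then (w, v) \in E else (v, w) \in E) && walk_ok E v s'
  end.

Definition walk_end n (a : 'I_n) (s : seq (bool * 'I_n)) : 'I_n :=
  last a (map snd s).

(* Conditions on the internal vertices.  [din] records whether the edge
   entering the current vertex u has an arrowhead at u; u is a collider iff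
   din holds and the next edge also points into u (d = false). *)
Fixpoint internal_active n (E : digraph n) (Z : {set 'I_n})
    (din : bool) (u : 'I_n) (s : seq (bool * 'I_n)) : bool :=
  match s with
  | [::] => true
  | (d, v) :: s' =>
      (if din && ~~ d
       then [exists x in Z, descendant E u x]
       else u \notin Z)
      && internal_active E Z d v s'
  end.

Definition walk_active n (E : digraph n) (Z : {set 'I_n})
    (a : 'I_n) (s : seq (bool * 'I_n)) : bool :=
  match s with
  | [::] => true
  | (d, v) :: s' => internal_active E Z d v s'
  end.

Definition d_connected n (E : digraph n) (a b : 'I_n) (Z : {set 'I_n}) : Prop :=
  a != b /\
  exists s : seq (bool * 'I_n),
    [&& walk_ok E a s, walk_end a s == b & walk_active E Z a s].

Definition d_separated n (E : digraph n) (a b : 'I_n) (Z : {set 'I_n}) : Prop :=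
  ~ d_connected E a b Z.

Definition markov_equiv n (E F : digraph n) : Prop :=
  forall (a b : 'I_n) (Z : {set 'I_n}), a != b -> a \notin Z -> b \notin Z ->
    (d_separated E a b Z <-> d_separated F a b Z).

Definition MEC n (G : digraph n) : {set digraph n} :=
  [set H : digraph n | is_dag H && `[< markov_equiv G H >]].

Definition dag_weight (R : realType) n (p : R) (G : digraph n) : R :=
  (p / (1 - p)) ^+ #|G|.

Definition dag_Z (R : realType) n (p : R) : R :=
  \sum_(G : digraph n | is_dag G) dag_weight p G.

Definition dag_prob (R : realType) n (p : R) (A : pred (digraph n)) : R :=
  (\sum_(G : digraph n | is_dag G && A G) dag_weight p G) / dag_Z n p.

Definition dag_expect (R : realType) n (p : R) (X : digraph n -> R) : R :=
  (\sum_(G : digraph n | is_dag G) dag_weight p G * X G) / dag_Z n p.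

Definition mec_bound (R : realType) (c p : R) : R :=
  2 `^ (c * p^-1 / (ln (p^-1)) ^+ 2).

Arguments dag_weight {R} n p G.
Arguments dag_Z {R} n p.
Arguments dag_prob {R} n p A.
Arguments dag_expect {R} n p X.

(* Main.v *)
(** Reversing an edge [u -> v] such that [u] is a source and [u] is the only parent of
    [v] gives a Markov equivalent DAG, and for distinct [u] these edges are disjoint, so
    they can be reversed independently: if [D] sources have such a private child, the
    class has at least [2 ^ D] elements.  The number [D] is bounded below by the first
    two moments of the number [X] of such edges.  With [q = 1 - p], [a_n] the total
    weight of the DAGs on [n] vertices, [h_n = a_n q^C(n,2) / n!] and
    [r_n = h_{n-1} / h_n] (the mean number of sources), one finds
    [E X = p r_n r_{n-1}] and similar formulas for the second moments.  The one thing
    needed is that [r_n] is nondecreasing: then [E X^2 <= (E X)^2 + O(p r_n E X)], and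
    [r_n >= 1/(4p)] follows from the trivial bound [r_k >= k q^(k-1)] at [k ~ 1/(2p)].
    Monotonicity is the log-concavity of [h], the coefficient sequence of
    [1 / psi(z)], [psi(z) = sum_k q^C(k,2) (-z)^k / k!] (Robinson).  It holds because
    [psi] is a limit of polynomials with only positive roots, and multiplying by
    [1 / (1 - c z)] preserves log-concavity. *)

Require Import Defs.
From HB Require Import structures.
From mathcomp Require Import all_boot all_order all_algebra.
From mathcomp Require Import all_classical all_reals all_analysis.
From mathcomp Require Import ring lra zify.
From mathcomp Require polyrcf.
Import Order.TTheory GRing.Theory Num.Theory.
Import numFieldNormedType.Exports.
Local Open Scope ring_scope.
Set Implicit Arguments.
Unset Strict Implicit.
Unset Printing Implicit Defensive.

(** * Acyclic graphs and private children *)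

(** Transfers reachability from one graph to another that agrees with it on a region which no edge
    leaves. *)
Lemma connect_invariant (T : finType) (e f : rel T) (A : pred T) x y :
  (forall x y, A x -> e x y -> A y /\ f x y) ->
  A x -> connect e x y -> A y /\ connect f x y.
Proof.
move=> ef Ax /connectP[s]; elim: s x Ax => [|z s IHs] x Ax /=.
  by move=> _ ->; split => //; apply: connect0.
case/andP=> exz es ey; have [Az fxz] := ef _ _ Ax exz.
by have [Ay fzy] := IHs _ Az es ey; split=> //; apply: connect_trans (connect1 fxz) fzy.
Qed.

(** The backward counterpart, for a region which no edge enters from outside. *)
Lemma connect_coinvariant (T : finType) (e f : rel T) (A : pred T) x y :
  (forall x y, A y -> e x y -> A x /\ f x y) ->
  A y -> connect e x y -> A x /\ connect f x y.
Proof.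
move=> ef Ay /connectP[s]; elim: s x => [|z s IHs] x /=.
  by move=> _ <-; split => //; apply: connect0.
case/andP=> exz es ey; have [Az fzy] := IHs _ es ey.
by have [Ax fxz] := ef _ _ Az exz; split=> //; apply: connect_trans (connect1 fxz) fzy.
Qed.

Lemma is_dagP n (G : digraph n) :
  reflect (forall u v, (u, v) \in G -> ~~ connect (edge_rel G) v u) (is_dag G).
Proof.
apply: (iffP forallP) => [dG u v uv|dG u].
  by move/forallP/(_ v)/implyP/(_ uv): (dG u).
by apply/forallP=> v; apply/implyP; apply: dG.
Qed.

Lemma sub_is_dag n (G H : digraph n) : H \subset G -> is_dag G -> is_dag H.
Proof.
move=> sHG /is_dagP dG; apply/is_dagP=> u v uv.
have := dG u v (fintype.subsetP sHG _ uv); apply: contraNN.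
apply: connect_sub => x y xy; apply: connect1; exact: (fintype.subsetP sHG).
Qed.

Lemma rank_is_dag n (G : digraph n) (rk : 'I_n -> nat) :
  (forall u v, (u, v) \in G -> rk u < rk v)%N -> is_dag G.
Proof.
move=> rkG; apply/is_dagP=> u v uv; apply/negP=> vu.
suff : (rk v <= rk u)%N by rewrite leqNgt rkG.
case/connectP: vu => s; elim: s v {uv} => [|z s IHs] v /=; first by move=> _ ->.
by case/andP=> /rkG/ltnW vz ps us; apply: leq_trans vz (IHs _ ps us).
Qed.

(** Tails are not restricted to [T], so prescribing this set as some [K] inside [T] also forbids
    parents outside [T]. *)
Definition inedges n (G : digraph n) (T : {set 'I_n}) : digraph n :=
  [set e in G | e.2 \in T].

(** Stated through [inedges] so that the probability of the event is an instance of one general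
    formula, [dag_expect_inedges]; [private_pairP] gives the graph-theoretic reading. *)
Definition private_pair n (G : digraph n) (u v : 'I_n) :=
  (u != v) && (inedges G [set u; v] == [set (u, v)]).

Lemma private_pairP n (G : digraph n) (u v : 'I_n) :
  reflect [/\ u != v, (u, v) \in G, forall x, (x, u) \notin G &
             forall x, (x, v) \in G -> x = u] (private_pair G u v).
Proof.
apply: (iffP andP) => [[uv /eqP E]|[uv Guv su pv]]; split=> //.
- by have := set11 (u, v); rewrite -E inE => /andP[].
- move=> x; apply/negP => xu; have : (x, u) \in [set (u, v)] by rewrite -E !inE xu eqxx.
  by rewrite inE xpair_eqE (negbTE uv) andbF.
- move=> x xv; have : (x, v) \in [set (u, v)] by rewrite -E !inE xv eqxx orbT.
  by rewrite inE xpair_eqE => /andP[/eqP].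
apply/eqP/setP=> -[x y]; rewrite !inE /= xpair_eqE.
apply/idP/idP => [/andP[xy /orP[/eqP yu|/eqP yv]]|/andP[/eqP-> /eqP->]].
- by rewrite yu (negbTE (su x)) in xy.
- by rewrite yv eqxx andbT; apply/eqP/pv; rewrite -yv.
- by rewrite Guv eqxx orbT.
Qed.

Arguments private_pairP {n G u v}.

(** * Reversing a private edge *)

Definition flip n (G : digraph n) (u v : 'I_n) : digraph n :=
  (v, u) |: (G :\ (u, v)).

Section Flip.
Variables (n : nat) (G : digraph n) (u v : 'I_n).
Hypothesis Puv : private_pair G u v.

Lemma in_flip x y : ((x, y) \in flip G u v) =
  ((x == v) && (y == u)) || (~~ ((x == u) && (y == v)) && ((x, y) \in G)).
Proof. by rewrite !inE !xpair_eqE. Qed.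

Lemma in_flip_away x y : y \notin [set u; v] ->
  ((x, y) \in flip G u v) = ((x, y) \in G).
Proof.
by rewrite !inE negb_or => /andP[/negbTE yu /negbTE yv]; rewrite !xpair_eqE yu yv !andbF.
Qed.

(** With [flipK], this makes the situation symmetric, so that later facts about flips need only one
    direction. *)
Lemma flip_private : private_pair (flip G u v) v u.
Proof.
have [uv Guv su pv] := private_pairP Puv.
apply/private_pairP; split; rewrite 1?eq_sym //.
- by rewrite in_flip !eqxx.
- move=> x; rewrite in_flip [v == u]eq_sym (negbTE uv) andbF eqxx andbT /=.
  by apply/negP => /andP[/eqP xu /pv].
- move=> x; rewrite in_flip eqxx andbT (negbTE uv) andbF /= (negbTE (su x)) orbF.
  by move/eqP.
Qed.

Lemma flipK : flip (flip G u v) v u = G.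
Proof.
have [uv Guv su pv] := private_pairP Puv.
apply/setP=> -[x y]; rewrite !inE !xpair_eqE.
have [/andP[/eqP-> /eqP->]|xyuv] := boolP ((x == u) && (y == v)); first by rewrite Guv.
rewrite /=; have [/andP[/eqP-> /eqP->]|//] := boolP ((x == v) && (y == u)).
by rewrite (negbTE (su v)).
Qed.

Lemma private_flip x y : [disjoint [set u; v] & [set x; y]] ->
  private_pair G x y -> private_pair (flip G u v) x y.
Proof.
move=> dj /andP[xy /eqP E]; rewrite /private_pair xy /= -E; apply/eqP/setP=> -[s t].
rewrite inE [RHS]inE /=; have [txy|] := boolP (t \in [set x; y]); last by rewrite !andbF.
by rewrite in_flip_away // (disjointFl dj).
Qed.

(** No edge enters the pair from outside, as [u] has no parent and [v] only the parent [u]; a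
    directed path starting outside therefore never meets the reversed edge. *)
Lemma connect_out x y : x \notin [set u; v] -> connect (edge_rel G) x y ->
  connect (edge_rel (flip G u v)) x y.
Proof.
have [uv Guv su pv] := private_pairP Puv.
move=> xuv cxy.
have [] // := @connect_invariant _ (edge_rel G) (edge_rel (flip G u v))
   [pred z | z \notin [set u; v]] x y _ xuv cxy.
move=> {xuv cxy} {}x {}y /= xuv xy.
have yuv : y \notin [set u; v].
  apply/negP; rewrite !inE => /orP[/eqP yu|/eqP yv].
    by move: xy; rewrite yu /edge_rel (negbTE (su x)).
  by move: xuv; rewrite (pv x) ?inE ?eqxx // -yv.
by split=> //; rewrite /edge_rel in_flip_away.
Qed.

End Flip.

(** After the flip [v] is a source and [u] has [v] as its only parent, so no cycle visits the pair;
    a cycle avoiding the pair would already be one in [G]. *)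
Lemma flip_dag n (G : digraph n) (u v : 'I_n) :
  private_pair G u v -> is_dag G -> is_dag (flip G u v).
Proof.
move=> Puv /is_dagP dG; have Pvu := flip_private Puv.
have [vu _ sv pu] := private_pairP Pvu.
apply/is_dagP=> x y xy; apply/negP=> yx.
have [yuv|] := boolP (y \in [set u; v]); last first.
  move=> yuv; rewrite in_flip_away // in xy; move/negP: (dG _ _ xy); apply.
  by rewrite -(flipK Puv); apply: connect_out => //; rewrite finset.setUC.
move: yuv; rewrite !inE => /orP[]/eqP ey; last by rewrite ey (negbTE (sv x)) in xy.
have ex : x = v by apply: pu; rewrite ey in xy.
move: yx; rewrite ex ey => /connectP[s]; case/lastP: s => [_ /=e|s z].
  by rewrite e eqxx in vu.
rewrite rcons_path last_rcons => /andP[_ ez] e; move: ez.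
by rewrite -e /edge_rel (negbTE (sv _)).
Qed.

(** * Active walks and d-connection under a flip *)

Definition step_ok n (E : digraph n) (Z : {set 'I_n}) (o : option bool)
    (x : 'I_n) (d : bool) : bool :=
  match o with
  | None => true
  | Some din => if din && ~~ d then [exists z in Z, descendant E x z]
                else x \notin Z
  end.

Definition step_edge n (E : digraph n) (x : 'I_n) (d : bool) (y : 'I_n) : bool :=
  if d then (x, y) \in E else (y, x) \in E.

(* [active_state E Z a o x]: some walk from a to x all of whose internal vertices
   satisfy the activity condition ends with an edge of orientation [o]
   ([None] for the empty walk); growing walks at the end lets one argue by induction. *)
Inductive active_state n (E : digraph n) (Z : {set 'I_n}) (a : 'I_n) :
    option bool -> 'I_n -> Prop :=
| active_start : active_state E Z a None a
| active_step o x d y : active_state E Z a o x -> step_edge E x d y ->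
    step_ok E Z o x d -> active_state E Z a (Some d) y.

Lemma active_state_walk n (E : digraph n) (Z : {set 'I_n}) a o x s :
  active_state E Z a o x -> walk_ok E x s ->
  (if o is Some d then internal_active E Z d x s else walk_active E Z x s) ->
  exists o', active_state E Z a o' (walk_end x s).
Proof.
elim: s o x => [|[d y] s IHs] o x ax /=; first by exists o.
case/andP=> exy ws act; apply: (IHs (Some d) y) => //.
  apply: active_step ax exy _; rewrite /step_ok.
  by case: o act => // d' /andP[].
by case: o act {ax} => // d' /andP[].
Qed.

(** Bridges the front-to-back recursion of walks and growth at the end: the new condition sits at
    the junction and depends on the last step of [s], or on [o] if [s] is empty. *)
Lemma walk_rcons n (E : digraph n) (Z : {set 'I_n}) o a s d y :
  walk_ok E a s -> step_edge E (walk_end a s) d y ->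
  (if o is Some d then internal_active E Z d a s else walk_active E Z a s) ->
  step_ok E Z (if s is _ :: _ then Some (last (d, y) s).1 else o) (walk_end a s) d ->
  walk_ok E a (rcons s (d, y)) /\
  (if o is Some d0 then internal_active E Z d0 a (rcons s (d, y))
   else walk_active E Z a (rcons s (d, y))).
Proof.
elim: s o a => [|[d' z] s IHs] o a /=.
  by rewrite /walk_end /= /step_edge => _ -> _; case: o => //= b ->.
case/andP=> az ws exy act ok.
have act' : internal_active E Z d' z s by case: o act {ok} => // b /andP[].
have [|ws' act2] := IHs (Some d') z ws exy act'.
  by move: ok; case: s {IHs ws exy act act'}.
split; first by rewrite az.
by case: o act {ok} => //= b /andP[-> _].
Qed.

Lemma active_walk n (E : digraph n) (Z : {set 'I_n}) a o x :
  active_state E Z a o x ->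
  exists s, [/\ walk_ok E a s, walk_end a s = x, walk_active E Z a s &
    o = if s is (d, y) :: s' then Some (last (d, y) s').1 else None].
Proof.
elim=> {o x} [|o x d y _ [s [ws <- act ->]] exy ok]; first by exists [::].
exists (rcons s (d, y)).
have [|ws' act'] := @walk_rcons n E Z None a s d y ws exy act.
  by case: s ok {ws act exy} => // -[].
split=> //; first by rewrite /walk_end map_rcons last_rcons.
by case: s {ws act exy ok ws' act'} => //= -[d' y'] s; rewrite last_rcons.
Qed.

Lemma d_connectedP n (E : digraph n) a b Z :
  d_connected E a b Z <-> a != b /\ exists o, active_state E Z a o b.
Proof.
split=> -[ab]; case.
  move=> s /and3P[ws /eqP e act]; split=> //; rewrite -e.
  exact: (@active_state_walk n E Z a None a s (active_start E Z a) ws act).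
move=> o /active_walk[s [ws e act _]]; split=> //.
by exists s; rewrite ws e eqxx act.
Qed.


(* A walk reaching [v] through [u -> v] may turn back at the collider [v]; there the
   walk in the flipped graph is cut at [u], which is what the last clause provides. *)
Lemma flip_active n (G : digraph n) (u v : 'I_n) (Z : {set 'I_n}) a o x :
  private_pair G u v -> active_state G Z a o x ->
  exists o', [/\ active_state (flip G u v) Z a o' x,
    x \notin [set u; v] \/ o = None -> o' = o &
    x = v -> o = Some true -> exists o'', active_state (flip G u v) Z a o'' u].
Proof.
move=> Puv; have [uv Guv su pv] := private_pairP Puv.
have Pvu := flip_private Puv; have [vu Gvu sv pu] := private_pairP Pvu.
elim=> {o x} [|o x d y ax [ o1 [ax1 eq1 ov]] exy ok].
  by exists None; split=> //; apply: active_start.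
(* A vertex left along an outgoing edge is a non-collider whatever edge entered it, so a changed
   incoming orientation does no harm. *)
have okT w : o1 <> None -> step_ok G Z o w true -> step_ok (flip G u v) Z o1 w true.
  case: o {ax ov ok} eq1 => [b|] eq1 oN; last by case: oN; apply: eq1; right.
  by rewrite /= andbF; case: (o1) oN => // b1 _; rewrite /= andbF.
have okN w : step_ok G Z o w true -> step_ok (flip G u v) Z o1 w true.
  by case: (o1) okT => // b; apply.
have [xu|xNu] := eqVneq x u.
  subst x; case: d exy ok => exy ok; last by move: exy; rewrite /step_edge (negbTE (su y)).
  have [yv|yNv] := eqVneq y v.
    subst y; suff [ o2 ao2] : exists o2, active_state (flip G u v) Z a o2 v.
      by exists o2; split=> //; [rewrite !inE eqxx orbT => -[] | exists o1].
    (* In the flipped graph an arrowhead at [u] can only come from [v], so a walk that would make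
       [u] a collider has just been at [v] and is cut there. *)
    case eo: o1 => [[]|].
    - rewrite eo in ax1; inversion ax1 as [|o2 z d w az ez _ e1 e2]; subst.
      by have ezv : z = v by [apply: pu]; subst z; exists o2.
    - exists (Some false); apply: active_step ax1 _ _ => //.
      by have := okN _ ok; rewrite eo.
    - by rewrite eo in ax1; exists (Some false); apply: active_step ax1 _ _.
  have yuv : y \notin [set u; v].
    rewrite !inE negb_or yNv andbT; apply/eqP => yu.
    by move: exy; rewrite yu /step_edge (negbTE (su u)).
  exists (Some true); split=> //; last by move/eqP; rewrite (negbTE yNv).
  by apply: active_step ax1 _ (okN _ ok); rewrite /step_edge in_flip_away.
have [xv|xNv] := eqVneq x v.
  subst x; case: d exy ok => exy ok.
    have yuv : y \notin [set u; v].
      rewrite !inE negb_or; apply/andP; split; apply/eqP => ey.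
        by move: exy; rewrite ey /step_edge (negbTE (su v)).
      by move: exy; rewrite ey /step_edge => /pv/eqP; rewrite (negbTE vu).
    exists (Some true); split=> //.
      by apply: active_step ax1 _ (okN _ ok); rewrite /step_edge in_flip_away.
    by move=> yv; rewrite yv !inE eqxx orbT in yuv.
  have yu : y = u by apply: pv.
  subst y; suff [ o2 ao2] : exists o2, active_state (flip G u v) Z a o2 u.
    by exists o2; split=> //; rewrite !inE eqxx => -[].
  have [eT|oNT] := eqVneq o (Some true); first exact: ov.
  exists (Some true); apply: active_step ax1 _ _ => //.
  by apply: okN; case: (o) oNT ok => // -[].
have xuv : x \notin [set u; v] by rewrite !inE negb_or xNu.
rewrite eq1 in ax1; last by left.
exists (Some d); split=> //; last first.
  by move=> yv [dT]; move: exy; rewrite dT yv /step_edge => /pv/eqP; rewrite (negbTE xNu).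
apply: active_step ax1 _ _.
  case: d {ok} exy; rewrite /step_edge; last by rewrite in_flip_away.
  move=> xy; rewrite in_flip_away // !inE negb_or; apply/andP; split; apply/eqP=> ey.
    by rewrite ey (negbTE (su x)) in xy.
  by move: xy; rewrite ey => /pv/eqP; rewrite (negbTE xNu).
(* A collider outside the pair keeps its descendants, by [connect_out]. *)
case: (o) ok => //= b; case: ifP => // _ /existsP[z /andP[zZ xz]].
by apply/existsP; exists z; rewrite zZ; apply: connect_out.
Qed.

Lemma flip_markov n (G : digraph n) (u v : 'I_n) :
  private_pair G u v -> markov_equiv G (flip G u v).
Proof.
move=> Puv a b Z _ _ _; rewrite /d_separated !d_connectedP.
split=> nc [ab [ o act]]; apply: nc; split=> //.
  have [ o1 [act1 _ _]] := flip_active (flip_private Puv) act.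
  by exists o1; rewrite flipK in act1.
by have [ o1 [act1 _ _]] := flip_active Puv act; exists o1.
Qed.

Lemma markov_equiv_trans n (E F H : digraph n) :
  markov_equiv E F -> markov_equiv F H -> markov_equiv E H.
Proof. by move=> EF FH a b Z ab aZ bZ; rewrite EF // FH. Qed.

(** * Flipping several private edges independently *)

Section FlipSet.
Variables (n : nat) (G : digraph n) (U : {set 'I_n}) (f : 'I_n -> 'I_n).
Hypothesis Gf : forall u, u \in U -> private_pair G u (f u).

(** A source cannot be a child, and a child shared by two pairs would have two parents. *)
Lemma private_disjoint u x : u \in U -> x \in U -> u != x ->
  [disjoint [set u; f u] & [set x; f x]].
Proof.
move=> uU xU ux.
have [ufu Gu su pu] := private_pairP (Gf uU).
have [xfx Gx sx px] := private_pairP (Gf xU).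
rewrite fintype.disjoint_subset; apply/fintype.subsetP=> y; rewrite !inE.
case/orP=> /eqP ->; rewrite negb_or.
  rewrite ux; apply/eqP=> e; by rewrite -e (negbTE (su x)) in Gx.
apply/andP; split; apply/eqP => e; first by rewrite e (negbTE (sx u)) in Gu.
by move: Gu; rewrite e => /px/eqP; rewrite (negbTE ux).
Qed.

Definition flips (s : seq 'I_n) : digraph n := foldr (fun u H => flip H u (f u)) G s.

(** By disjointness each flip leaves the other pairs private. The orientation of a pair thus records
    whether it was flipped, which is what makes the resulting graphs distinct. *)
Lemma flipsP s : uniq s -> {subset s <= U} -> is_dag G ->
  [/\ is_dag (flips s), markov_equiv G (flips s) &
    forall u, u \in U -> if u \in s then private_pair (flips s) (f u) u
                         else private_pair (flips s) u (f u)].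
Proof.
move=> + + dG; elim: s => [|x s IHs] /=; first by move=> _ _; split=> // u /Gf.
case/andP=> xs us sU; have xU : x \in U by apply: sU; rewrite mem_head.
have [|ds ms Ps] := IHs us; first by move=> y ys; apply: sU; rewrite in_cons ys orbT.
have Px : private_pair (flips s) x (f x) by have := Ps x xU; rewrite (negbTE xs).
split; first exact: flip_dag.
  by apply: markov_equiv_trans ms _; apply: flip_markov.
move=> u uU; rewrite in_cons; have [->|ux] /= := eqVneq u x; first exact: flip_private.
have dj : [disjoint [set x; f x] & [set u; f u]] by apply: private_disjoint; rewrite 1?eq_sym.
case: ifP (Ps u uU) => _ Pu; apply: private_flip => //.
by rewrite (finset.setUC [set f u]).
Qed.

Lemma card_MEC_private : is_dag G -> (2 ^ #|U| <= #|MEC G|)%N.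
Proof.
move=> dG; rewrite -card_powerset.
have PB (B : {set 'I_n}) : B \in powerset U -> {subset enum B <= U}.
  by rewrite inE => /fintype.subsetP BU x; rewrite mem_enum => /BU.
rewrite -(@card_in_imset _ _ (fun B : {set 'I_n} => flips (enum B))).
  apply/subset_leq_card/fintype.subsetP=> _ /imsetP[B BU ->].
  have [dB mB _] := flipsP (enum_uniq B) (PB _ BU) dG.
  by rewrite inE dB; apply/asboolP.
(* The flipped set can be read off the graph, so the map on subsets of [U] is injective. *)
have mem_flips (B : {set 'I_n}) u : B \in powerset U -> u \in U ->
    (u \in B) = ((u, f u) \notin flips (enum B)).
  move=> BU uU; have [_ _ /(_ u uU)] := flipsP (enum_uniq B) (PB _ BU) dG.
  rewrite mem_enum; case: ifP => uB /private_pairP[_ uf su pu]; first by rewrite su.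
  by rewrite uf.
move=> B C BU CU /= e; apply/setP=> u.
have [uU|uU] := boolP (u \in U); first by rewrite (mem_flips B) ?(mem_flips C) ?e.
rewrite !inE in BU CU.
by rewrite (contraNF (fintype.subsetP BU u)) // (contraNF (fintype.subsetP CU u)).
Qed.
End FlipSet.

Lemma leq_card_MEC n (G : digraph n) : is_dag G ->
  (2 ^ #|[set u | [exists v, private_pair G u v]]| <= #|MEC G|)%N.
Proof.
(* The default is never taken on the set in question, where a private child exists. *)
move=> dG; pose f u := odflt u [pick v | private_pair G u v].
apply: (@card_MEC_private _ _ _ f) => // u; rewrite inE => /existsP[v uv].
by rewrite /f; case: pickP => [//|/(_ v)]; rewrite uv.
Qed.

(** * A real-rooted family of polynomials *)

Section RealRooted.
Variables (R : realType) (q : R).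
Hypothesis (q0 : 0 < q) (q1 : q < 1).

(** Polynomial stand-in for psi: under [z -> z / N] its coefficients converge to those of psi, while
    its recursion in [N] allows the roots to be located by induction. *)
Definition qexp_poly (N : nat) : {poly R} :=
  \poly_(j < N.+1) ((-1) ^+ j * 'C(N, j)%:R * q ^+ 'C(j, 2)).

Lemma coef_qexp_poly N j :
  (qexp_poly N)`_j = (-1) ^+ j * 'C(N, j)%:R * q ^+ 'C(j, 2).
Proof.
rewrite coef_poly ltnS; case: leqP => // Nj.
by rewrite bin_small // mulr0 mul0r.
Qed.

Lemma size_qexp_poly N : size (qexp_poly N) = N.+1.
Proof.
rewrite size_poly_eq // binn mulr1 mulf_neq0 // ?signr_eq0 //.
by rewrite expf_neq0 // gt_eqF.
Qed.

(** Pascal's rule, together with ['C(j.+1, 2) = 'C(j, 2) + j]; the extra factor [q ^+ j] rescales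
    the argument to [q * x]. *)
Lemma horner_qexp_polyS N x :
  (qexp_poly N.+1).[x] = (qexp_poly N).[x] - x * (qexp_poly N).[q * x].
Proof.
rewrite (@horner_coef_wide _ N.+2 (qexp_poly N.+1)) ?size_qexp_poly //.
rewrite (@horner_coef_wide _ N.+2 (qexp_poly N)) ?size_qexp_poly //.
rewrite horner_coef size_qexp_poly mulr_sumr.
rewrite big_ord_recl [X in _ = X - _]big_ord_recl /= -addrA; congr (_ + _).
  by rewrite !coef_qexp_poly !bin0.
rewrite -sumrB; apply: eq_bigr => j _.
rewrite /bump /= !add1n !coef_qexp_poly binS natrD exprMn binS bin1 exprD !exprS.
by ring.
Qed.

Definition roots_prod (z : nat -> R) N x := \prod_(j < N) (1 - x / z j).

(** Exactly the first [i] factors are negative at [x]. *)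
Lemma sgr_roots_prod (z : nat -> R) N i x : (i <= N)%N ->
  (forall j, (j < N)%N -> 0 < z j) ->
  (forall j, (j < i)%N -> z j < x) -> (forall j, (i <= j < N)%N -> x < z j) ->
  0 < (-1) ^+ i * roots_prod z N x.
Proof.
move=> + z0; elim: N z0 => [|N IHN] z0.
  by rewrite leqn0 => /eqP -> _ _; rewrite /roots_prod big_ord0 mulr1.
rewrite leq_eqVlt => /orP[/eqP-> zx _|iN zx xz]; last first.
  rewrite /roots_prod big_ord_recr /= mulrA mulr_gt0 //.
    apply: IHN => // [j jN|j /andP[ij jN]]; first by apply: z0; rewrite ltnW.
    by apply: xz; rewrite ij ltnW.
  by rewrite subr_gt0 ltr_pdivrMr ?z0 // mul1r xz // leqnn andbT.
rewrite /roots_prod; elim: N.+1 z0 zx {IHN} => [|M IHM] z0 zx.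
  by rewrite big_ord0 mulr1.
rewrite big_ord_recr exprSr /= mulrACA mulr_gt0 //.
  by apply: IHM => j jM; [apply: z0|apply: zx]; rewrite ltnW.
by rewrite mulN1r opprB subr_gt0 ltr_pdivlMr ?z0 // mul1r zx.
Qed.

(* Consecutive positive roots are a factor [q^-1] apart. *)
Definition separated (z : nat -> R) N :=
  (forall j, (j < N)%N -> 0 < z j) /\ (forall j, (j.+1 < N)%N -> z j < q * z j.+1).

Lemma separated_ltS z N j : separated z N -> (j.+1 < N)%N -> z j < z j.+1.
Proof.
move=> [z0 zq] jN; apply: lt_trans (zq _ jN) _.
by rewrite gtr_pMl // z0.
Qed.

Lemma separated_le z N i j : separated z N -> (i <= j < N)%N -> z i <= z j.
Proof.
move=> sz; elim: j => [|j IHj]; first by rewrite leqn0 => /andP[/eqP->].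
rewrite leq_eqVlt => /andP[/orP[/eqP->//|ij] jN].
by rewrite (le_trans (IHj _)) ?(ltW (separated_ltS sz jN)) // -ltnS ij ltnW.
Qed.

(** Degree [N] and [N] distinct roots determine the polynomial up to a constant, which the value 1
    at 0 fixes. *)
Lemma qexp_roots_prod z N : separated z N ->
  (forall j, (j < N)%N -> root (qexp_poly N) (z j)) ->
  forall x, (qexp_poly N).[x] = roots_prod z N x.
Proof.
move=> sz rz x; have [z0 zq] := sz.
have nz j : (j < N)%N -> z j != 0 by move=> /z0; rewrite lt0r => /andP[].
have E : qexp_poly N = lead_coef (qexp_poly N) *: \prod_(t <- mkseq z N) ('X - t%:P).
  apply: all_roots_prod_XsubC; rewrite ?size_qexp_poly ?size_mkseq //.
    by apply/allP => _ /mapP[j jN ->]; apply: rz; rewrite mem_iota in jN.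
  rewrite uniq_rootsE; apply: lt_sorted_uniq.
  apply/(sortedP 0) => j; rewrite size_mkseq => jN; rewrite !nth_mkseq ?(ltnW jN) //.
  exact: separated_ltS jN.
have {E} H y : (qexp_poly N).[y] = lead_coef (qexp_poly N) * \prod_(j < N) (y - z j).
  have e0 : iota 0 N = index_iota 0 N by rewrite /index_iota subn0.
  rewrite {1}E hornerZ horner_prod /mkseq big_map e0 big_mkord.
  by congr (_ * _); apply: eq_bigr => j _; rewrite hornerXsubC.
have H0 : 1 = lead_coef (qexp_poly N) * \prod_(j < N) (0 - z j).
  by rewrite -H horner_coef0 coef_qexp_poly !bin0 expr0 !mul1r.
have P0 : \prod_(j < N) (0 - z j) != 0.
  by apply/prodf_neq0 => j _; rewrite sub0r oppr_eq0 nz.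
rewrite H -[LHS](mulfK P0) [_ * _ * \prod_(j < N) (0 - _)]mulrAC -H0 mul1r /roots_prod -prodf_div.
by apply: eq_bigr => j _; field; rewrite nz.
Qed.

(* Since [f_{N+1}(x) = f_N(x) - x f_N(q x)], the sign of [f_{N+1}] at [z_{i-1} / q] is
   that of [f_N] there, and at [z_i] it is opposite to that of [f_N (q z_i)]; so there is
   a root in each interval [(z_{i-1} / q, z_i)], and one beyond [z_{N-1} / q]. *)
Lemma qexp_poly_real_rooted N : exists z : nat -> R,
  separated z N /\ forall x, (qexp_poly N).[x] = roots_prod z N x.
Proof.
elim: N => [|N [z [sz Hz]]].
  exists (fun=> 0); split=> // x.
  by rewrite /roots_prod big_ord0 horner_coef size_qexp_poly big_ord1 coef_qexp_poly !bin0 !mulr1.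
have [z0 zq] := sz.
(* The polynomial is 1 at 0, so 0 can serve as the left end of the first interval. *)
pose l i := if i is k.+1 then z k / q else 0.
have l0 i : (i <= N)%N -> 0 <= l i.
  by case: i => //= i iN; rewrite divr_ge0 // ltW // z0.
have z_ltq j : (j < N)%N -> z j < z j / q.
  by move=> jN; rewrite ltr_pdivlMr // gtr_pMr // z0.
have lz i : (i < N)%N -> l i < z i.
  case: i => [|i] iN /=; first exact: z0.
  by rewrite ltr_pdivrMr // mulrC zq.
have sl i : (i <= N)%N -> 0 < (-1) ^+ i * (qexp_poly N.+1).[l i].
  rewrite horner_qexp_polyS; case: i => [|i] iN.
    by rewrite mul0r subr0 mul1r horner_coef0 coef_qexp_poly !bin0 expr0 !mul1r.
  rewrite /= [q * _]mulrC divfK ?gt_eqF // [X in _ - _ * X]Hz.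
  have -> : roots_prod z N (z i) = 0.
    by rewrite /roots_prod (bigD1 (Ordinal iN)) //= divff ?subrr ?mul0r // gt_eqF // z0.
  rewrite mulr0 subr0 Hz; apply: sgr_roots_prod => // j.
    rewrite ltnS => ji; apply: le_lt_trans (separated_le sz _) (z_ltq _ iN).
    by rewrite ji.
  move=> /andP[ij jN]; rewrite ltr_pdivrMr // mulrC.
  apply: lt_le_trans (zq _ (leq_ltn_trans ij jN)) _.
  by rewrite ler_pM2l //; apply: (separated_le sz); rewrite ij.
have su i : (i < N)%N -> (-1) ^+ i * (qexp_poly N.+1).[z i] < 0.
  move=> iN; rewrite horner_qexp_polyS [X in X - _]Hz.
  have -> : roots_prod z N (z i) = 0.
    by rewrite /roots_prod (bigD1 (Ordinal iN)) //= divff ?subrr ?mul0r // gt_eqF // z0.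
  rewrite sub0r mulrN oppr_lt0 mulrCA mulr_gt0 ?z0 // Hz.
  apply: (sgr_roots_prod (ltnW iN) z0) => j.
    case: i iN => // i iN; rewrite ltnS => ji.
    by apply: le_lt_trans (zq _ iN); apply: (separated_le sz); rewrite ji ltnW.
  move=> /andP[ij jN]; apply: lt_le_trans (_ : z i <= _); first by rewrite gtr_pMl // z0.
  by apply: (separated_le sz); rewrite ij.
(* The leading coefficient has sign [(-1) ^+ N.+1], which forces one more sign change far to the
   right. *)
have [X lX sX] : exists2 X, l N < X & (-1) ^+ N * (qexp_poly N.+1).[X] < 0.
  have : 0 < lead_coef ((-1) ^+ N.+1 *: qexp_poly N.+1).
    rewrite lead_coefZ lead_coefE size_qexp_poly coef_qexp_poly binn mulr1 mulrA -expr2 sqrr_sign mul1r.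
    exact: exprn_gt0.
  move=> lc; have [X HX] := polyrcf.poly_pinfty_gt_lc lc.
  exists (Num.max X (l N + 1)); first by rewrite lt_max ltrDl ltr01 orbT.
  have := lt_le_trans lc (HX (Num.max X (l N + 1)) _); rewrite le_max lexx => /(_ isT).
  by rewrite hornerZ exprS mulN1r mulNr oppr_gt0.
pose b i := if (i < N)%N then z i else X.
have [t Ht] : exists t : nat -> R, forall i, (i <= N)%N ->
    [/\ l i < t i, t i < b i & root (qexp_poly N.+1) (t i)].
  suff /choice[t Ht] : forall i, exists ti, (i <= N)%N ->
    [/\ l i < ti, ti < b i & root (qexp_poly N.+1) ti] by exists t.
  move=> i; have [iN|_] := leqP i N; last by exists 0.
  have [lb sb] : l i < b i /\ (-1) ^+ i * (qexp_poly N.+1).[b i] < 0.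
    rewrite /b; case: ltnP => Ni; first by split; [exact: lz|exact: su].
    by have -> : i = N by apply/eqP; rewrite eqn_leq iN.
  have [|c] := @polyrcf.poly_ivtoo _ (qexp_poly N.+1) _ _ (ltW lb).
    have := sl i iN; move: sb; set A := _.[b i]; set B := _.[l i].
    rewrite -signr_odd; case: odd; rewrite ?expr1 ?expr0 ?mulN1r ?mul1r ?oppr_lt0 ?oppr_gt0 => A0 B0.
      by rewrite nmulr_rlt0.
    by rewrite pmulr_rlt0.
  by rewrite in_itv /= => /andP[lc cb] rc; exists c.
(* Since [t j < z j] and [z j / q] is the left end of the interval of [t j.+1], the ratio of
   consecutive roots again exceeds [q^-1]. *)
have st : separated t N.+1.
  split=> [j jN|j]; first by have [lt _ _] := Ht j jN; apply: le_lt_trans (l0 _ jN) lt.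
  rewrite ltnS => jN; have [_ tb _] := Ht j (ltnW jN); have [lt _ _] := Ht j.+1 jN.
  rewrite /b jN in tb; apply: lt_trans tb _.
  by rewrite mulrC -ltr_pdivrMr.
exists t; split=> //; apply: qexp_roots_prod => // j; rewrite ltnS => jN.
by have [] := Ht j jN.
Qed.
End RealRooted.

(** * Log-concavity of reciprocal series *)

Definition conv (R : pzRingType) (e b : nat -> R) n := \sum_(i < n.+1) e i * b (n - i)%N.

Definition reciprocal (R : pzRingType) (e b : nat -> R) :=
  forall n, conv e b n = (n == 0%N)%:R.

Definition log_concave (R : realType) (b : nat -> R) :=
  forall n, b n * b n.+2 <= b n.+1 ^+ 2.

Section Geometric.
Variables (R : realType) (c : R).

(** The coefficients of the series of [b] divided by [1 - c z]. *)
Fixpoint geometric_conv (b : nat -> R) n :=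
  if n is m.+1 then c * geometric_conv b m + b n else b 0%N.

Lemma geometric_conv_gt0 b : 0 < c -> (forall n, 0 < b n) ->
  forall n, 0 < geometric_conv b n.
Proof.
by move=> c0 b0; elim=> [|n IHn] /=; rewrite ?b0 // addr_gt0 // mulr_gt0.
Qed.

(** Write g for the new sequence. As [g_{n+1} = c g_n + b_{n+1}], the difference
    [g_{n+1}^2 - g_n g_{n+2}] equals [b_{n+1} g_{n+1} - g_n b_{n+2}]; its nonnegativity is [P], an
    induction using the log-concavity of [b]. *)
Lemma geometric_conv_log_concave b : 0 < c -> (forall n, 0 < b n) ->
  log_concave b -> log_concave (geometric_conv b).
Proof.
move=> c0 b0 lc; have g0 := geometric_conv_gt0 c0 b0.
have gS n : geometric_conv b n.+1 = c * geometric_conv b n + b n.+1 by [].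
have P n : geometric_conv b n * b n.+2 <= b n.+1 * geometric_conv b n.+1.
  elim: n => [|n IHn].
    rewrite /=; apply: le_trans (lc 0%N) _; rewrite expr2 ler_pM2l //.
    by rewrite lerDr mulr_ge0 // ltW.
  rewrite (gS n.+1) {1}gS mulrDl mulrDr -expr2 lerD // ?lc //.
  (* Multiplying by [b n.+2] lets the induction hypothesis and log-concavity of [b] be chained. *)
  rewrite -mulrA [leRHS]mulrCA ler_pM2l // -(ler_pM2l (b0 n.+2)).
  apply: le_trans (_ : b n.+1 * b n.+3 * geometric_conv b n.+1 <= _).
    rewrite mulrCA mulrA [leRHS]mulrAC ler_pM2r //.
  by rewrite mulrA -expr2 ler_pM2r.
move=> n; rewrite expr2 (gS n.+1) {2}gS mulrDr mulrDl.
by rewrite mulrCA mulrA lerD.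
Qed.

Lemma geometric_conv_reciprocal (p : {poly R}) b :
  reciprocal (fun k => p`_k) b ->
  reciprocal (fun k => ((1 - c *: 'X) * p)`_k) (geometric_conv b).
Proof.
move=> rb; have E k : ((1 - c *: 'X) * p)`_k = p`_k - c * (if k is m.+1 then p`_m else 0).
  by rewrite mulrBl mul1r coefB -scalerAl coefZ coefXM; case: k.
case=> [|n]; rewrite -rb /conv; first by rewrite !big_ord1 E mulr0 subr0.
under eq_bigr do rewrite E mulrBl.
rewrite sumrB [X in _ - X]big_ord_recl mulr0 mul0r add0r.
rewrite big_ord_recr [RHS]big_ord_recr /= !subnn /= addrAC; congr (_ + _).
rewrite -sumrB; apply: eq_bigr => i _; rewrite /bump /= add1n subSS.
by rewrite subSn ?leq_ord //=; ring.
Qed.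
End Geometric.

Section LogConcaveLimit.
Local Open Scope classical_set_scope.
Local Open Scope ring_scope.
Variables (R : realType) (q : R).
Hypothesis (q0 : 0 < q) (q1 : q < 1).

Lemma horner_inj (p1 p2 : {poly R}) : (forall x, p1.[x] = p2.[x]) -> p1 = p2.
Proof.
move=> H; apply/eqP; rewrite -subr_eq0; apply/negPn/negP => p0.
pose rs := [seq i%:R : R | i <- iota 0 (size (p1 - p2))].
have := @max_poly_roots _ _ rs p0; rewrite size_map size_iota ltnn => H1.
suff : false by []; apply: H1.
  by apply/allP => x _; rewrite rootE hornerD hornerN H subrr.
by rewrite map_inj_uniq ?iota_uniq // => i j /eqP; rewrite eqr_nat => /eqP.
Qed.

(** Each linear factor contributes one geometric convolution. The induction starts from one factor,
    because the reciprocal of the empty product has vanishing coefficients and [b] must stay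
    positive. *)
Lemma qexp_poly_reciprocal N : (0 < N)%N -> exists b : nat -> R,
  [/\ forall n, 0 < b n, log_concave b & reciprocal (fun k => (qexp_poly q N)`_k) b].
Proof.
move=> N0; have [z [[z0 _] Hz]] := qexp_poly_real_rooted q0 q1 N.
have -> : qexp_poly q N = \prod_(j < N) (1 - (z j)^-1 *: 'X).
  apply: horner_inj => x; rewrite Hz horner_prod; apply: eq_bigr => j _.
  by rewrite hornerD hornerN hornerZ hornerX -(polyC1 R) hornerC [RHS]addrC [_^-1 * _]mulrC addrC.
elim: N N0 z0 {Hz} => // -[|N] IHN _ z0.
  exists (fun n => (z 0%N)^-1 ^+ n); split=> [n|n|].
  - by rewrite exprn_gt0 // invr_gt0 z0.
  - by rewrite -exprD -exprM muln2 -addnn addSnnS.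
  - move=> n; rewrite big_ord1 /conv.
    have E k : (1 - (z 0%N)^-1 *: 'X : {poly R})`_k = (k == 0%N)%:R - (z 0%N)^-1 * (k == 1%N)%:R.
      by rewrite coefB coef1 coefZ coefX.
    case: n => [|n]; first by rewrite big_ord1 E mulr0 subr0 mul1r.
    rewrite big_ord_recl big_ord_recl big1 => [|i _]; last first.
      by rewrite E /= mulr0 subrr mul0r.
    by rewrite !E /= mulr0 mulr1 subr0 sub0r subn0 /bump /= subSS subn0 exprS; ring.
have [//|j jN|b [b0 lc rb]] := IHN; first by apply: z0; apply: ltnW.
exists (geometric_conv (z N.+1)^-1 b); split.
- by apply: geometric_conv_gt0; rewrite // invr_gt0 z0.
- by apply: geometric_conv_log_concave; rewrite // invr_gt0 z0.
have -> : \prod_(j < N.+2) (1 - (z j)^-1 *: 'X) =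
    (1 - (z N.+1)^-1 *: 'X) * \prod_(j < N.+1) (1 - (z j)^-1 *: 'X).
  by rewrite big_ord_recr mulrC.
exact: geometric_conv_reciprocal.
Qed.

Lemma cvg_sum_ord (m : nat) (f : nat -> nat -> R) (l : nat -> R) :
  (forall i, (i < m)%N -> f i N @[N --> \oo] --> l i) ->
  (\sum_(i < m) f i N) @[N --> \oo] --> \sum_(i < m) l i.
Proof.
elim: m => [|m IHm] fl.
  under eq_fun do rewrite big_ord0.
  by rewrite big_ord0; apply: cvg_cst.
under eq_fun do rewrite big_ord_recr /=.
rewrite big_ord_recr /=; apply: cvgD; last exact: fl.
by apply: IHm => i im; apply: fl; apply: ltnW.
Qed.

(* The coefficients of [f_N (z / N)] tend to those of [sum_k q^C(k,2) (-z)^k / k!]. *)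
Lemma cvg_coef_qexp k :
  ((qexp_poly q N.+1)`_k / N.+1%:R ^+ k) @[N --> \oo] -->
    (-1) ^+ k * q ^+ 'C(k, 2) / (k`!)%:R.
Proof.
elim: k => [|k IHk].
  have E N : (qexp_poly q N.+1)`_0 / N.+1%:R ^+ 0 = 1.
    by rewrite coef_qexp_poly bin0 bin0n !expr0 !mulr1 invr1 ?mulr1.
  under eq_fun do rewrite E.
  by rewrite expr0 mul1r fact0 divr1; apply: cvg_cst.
have E N : (qexp_poly q N.+1)`_k.+1 / N.+1%:R ^+ k.+1 =
    (- q ^+ k / k.+1%:R) * ((qexp_poly q N.+1)`_k / N.+1%:R ^+ k * (1 - k%:R * harmonic N)).
  rewrite !coef_qexp_poly (binS k 1) bin1 exprD /harmonic /=.
  have : 'C(N.+1, k.+1)%:R * k.+1%:R = (N.+1%:R - k%:R) * 'C(N.+1, k)%:R :> R.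
    have [kN|Nk] := leqP k N.+1; last by rewrite !bin_small ?mulr0 ?mul0r // ltnW.
    by rewrite -natrB // -!natrM mulnC mul_bin_left.
  move=> /(canRL (mulfK _)) ->; last by rewrite pnatr_eq0.
  rewrite !exprS; field.
  by rewrite !nat1r !pnatr_eq0 expf_neq0 ?pnatr_eq0.
under eq_fun do rewrite E.
have -> : (-1) ^+ k.+1 * q ^+ 'C(k.+1, 2) / (k.+1`!)%:R =
   (- q ^+ k / k.+1%:R) * ((-1) ^+ k * q ^+ 'C(k, 2) / (k`!)%:R * (1 - k%:R * 0)) :> R.
  rewrite mulr0 subr0 mulr1 (binS k 1) bin1 exprD factS natrM exprS; field.
  by rewrite !nat1r !pnatr_eq0 -lt0n fact_gt0.
apply: cvgM; first exact: cvg_cst.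
apply: cvgM; first exact: IHk.
apply: cvgB; first exact: cvg_cst.
by apply: cvgM; [exact: cvg_cst|exact: cvg_harmonic].
Qed.

Lemma reciprocal_rec (e b : nat -> R) n : e 0%N = 1 -> reciprocal e b ->
  b n = (n == 0%N)%:R - \sum_(i < n) e i.+1 * b (n - i.+1)%N.
Proof. by move=> e0 <-; rewrite /conv big_ord_recl e0 mul1r subn0 addrK. Qed.

(** The rescaled reciprocals [t N] are log-concave. Each of their terms is a polynomial in earlier
    terms and in convergent coefficients, so it converges to that of [a], and the weak inequality
    passes to the limit. *)
Lemma reciprocal_log_concave (a : nat -> R) :
  reciprocal (fun k => (-1) ^+ k * q ^+ 'C(k, 2) / (k`!)%:R) a -> log_concave a.
Proof.
move=> ra.
have /choice[b Hb] := fun N => qexp_poly_reciprocal (ltn0Sn N).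
pose t N n := b N n / N.+1%:R ^+ n.
have rt N : reciprocal (fun k => (qexp_poly q N.+1)`_k / N.+1%:R ^+ k) (t N).
  move=> n; have [_ _ /(_ n) rb] := Hb N.
  transitivity (conv (fun k => (qexp_poly q N.+1)`_k) (b N) n / N.+1%:R ^+ n).
    rewrite /conv mulr_suml; apply: eq_bigr => i _.
    have -> : N.+1%:R ^+ n = N.+1%:R ^+ i * N.+1%:R ^+ (n - i) :> R.
      by rewrite -exprD subnKC // leq_ord.
    by rewrite invfM mulrACA.
  by rewrite rb; case: n {rb} => [|n]; rewrite ?mul0r // expr0 divr1.
have tcvg n : t N n @[N --> \oo] --> a n.
  elim/ltn_ind: n => n IHn.
  under eq_fun => N.
    rewrite (reciprocal_rec n _ (rt N)); last first.
      by rewrite coef_qexp_poly bin0 bin0n !expr0 !mulr1 invr1 ?mulr1.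
    over.
  rewrite (reciprocal_rec n _ ra); last by rewrite expr0 mul1r fact0 divr1.
  apply: cvgB; first exact: cvg_cst.
  apply: (@cvg_sum_ord n (fun i N => (qexp_poly q N.+1)`_i.+1 / N.+1%:R ^+ i.+1 * t N (n - i.+1)%N)
    (fun i => (-1) ^+ i.+1 * q ^+ 'C(i.+1, 2) / (i.+1`!)%:R * a (n - i.+1)%N)) => i im.
  apply: cvgM; first exact: cvg_coef_qexp.
  by apply: IHn; rewrite subnS; lia.
move=> n.
have cl : t N n * t N n.+2 @[N --> \oo] --> a n * a n.+2 by apply: cvgM; apply: tcvg.
have cr : t N n.+1 ^+ 2 @[N --> \oo] --> a n.+1 ^+ 2.
  by under eq_fun do rewrite expr2; rewrite expr2; apply: cvgM; apply: tcvg.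
apply: (ler_cvg_to cl cr).
apply: nearW => N; have [_ /(_ n) lc _] := Hb N.
rewrite /t mulrACA expr_div_n -invfM -exprD -exprM muln2 -addnn addSnnS addnS.
by rewrite ler_pM2r // invr_gt0 exprn_gt0.
Qed.
End LogConcaveLimit.

(** * Weighted sums over DAGs *)

Lemma sum_subset_expr (R : comPzRingType) (T : finType) (D : {set T}) (w : R) :
  \sum_(B : {set T} | B \subset D) w ^+ #|B| = (1 + w) ^+ #|D|.
Proof.
pose F i := if i \in D then w else 0.
transitivity (\prod_i (F i + 1)).
  rewrite bigA_distr [LHS]big_mkcond /=; apply: eq_bigr => B _; case: ifPn => BD.
    rewrite -big_mkcond /= (eq_bigr (fun=> w)) ?prodr_const // => i iB.
    by rewrite /F (fintype.subsetP BD).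
  have [x xB xD] := subsetPn BD.
  by rewrite (bigD1 x) //= xB /F (negbTE xD) mul0r.
rewrite (bigID (mem D)) /= [X in _ * X]big1 ?mulr1 => [|i /negbTE iD].
  rewrite (eq_bigr (fun=> 1 + w)) ?prodr_const // => i iD.
  by rewrite /F iD addrC.
by rewrite /F iD add0r.
Qed.

Lemma hom_is_dag m n (G : digraph m) (H : digraph n) (f : 'I_m -> 'I_n) :
  (forall u v, (u, v) \in G -> (f u, f v) \in H) -> is_dag H -> is_dag G.
Proof.
move=> fGH /is_dagP dH; apply/is_dagP=> u v uv.
apply/negP => /connectP[s]; move: (dH _ _ (fGH _ _ uv)) => /negP nc ps e.
apply: nc; rewrite e; elim: s v ps {uv e} => [|z s IHs] v /=; first by rewrite connect0.
case/andP=> vz ps; apply: connect_trans (IHs _ ps).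
by apply: connect1; apply: fGH.
Qed.

Lemma is_dag0 n : is_dag (finset.set0 : digraph n).
Proof. by apply: (@rank_is_dag _ _ (fun=> 0%N)) => u v; rewrite inE. Qed.

(** Take a vertex with the fewest ancestors: a parent of it would have strictly fewer. *)
Lemma dag_source n (G : digraph n) : (0 < n)%N -> is_dag G ->
  exists v, forall u, (u, v) \notin G.
Proof.
case: n G => // n G _ /is_dagP dG.
pose anc v := [set x | connect (edge_rel G) x v].
have [v _ minv] := arg_minnP (fun v => #|anc v|) (isT : (fun=> true) (ord0 : 'I_n.+1)).
exists v => u; apply/negP => uv.
have := minv u isT; rewrite leqNgt => /negP; apply.
apply/proper_card/properP; split.
  by apply/fintype.subsetP => x; rewrite !inE => xu; apply: connect_trans xu (connect1 _).
by exists v; rewrite inE ?connect0 // dG.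
Qed.

Section DagSums.
Variables (R : realType) (p : R).

Lemma dag_Z_sub n (S : {set 'I_n}) :
  \sum_(G : digraph n | is_dag G && (G \subset finset.setX S S)) dag_weight _ p G =
  dag_Z #|S| p.
Proof.
pose f (i : 'I_#|S|) : 'I_n := enum_val i.
have fI : injective f := @enum_val_inj _ _.
have f2I : injective (fun e : 'I_#|S| * 'I_#|S| => (f e.1, f e.2)).
  by move=> [a b] [c d] [/fI-> /fI->].
pose h (H : digraph #|S|) : digraph n := [set (f e.1, f e.2) | e in H].
pose h' (G : digraph n) : digraph #|S| := [set e | (f e.1, f e.2) \in G].
have hK H : h' (h H) = H.
  by apply/setP=> e; rewrite inE (mem_imset _ _ f2I).
have fS x (xS : x \in S) : exists i, f i = x.
  by exists (enum_rank_in xS x); rewrite /f enum_rankK_in.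
have h'K (G : digraph n) : G \subset finset.setX S S -> h (h' G) = G.
  move=> /fintype.subsetP GS; apply/setP=> -[x y]; apply/imsetP/idP.
    by case=> -[i j]; rewrite inE /= => ij [-> ->].
  move=> xy; have := GS _ xy; rewrite inE /= => /andP[/fS[i ei] /fS[j ej]].
  by exists (i, j); rewrite ?inE /= ?ei ?ej.
have hS H : h H \subset finset.setX S S.
  by apply/fintype.subsetP => _ /imsetP[e _ ->]; rewrite inE /= !enum_valP.
have dh H : is_dag (h H) = is_dag H.
  apply/idP/idP; first by apply: (@hom_is_dag _ _ _ _ f) => u v uv; apply: (imset_f _ uv).
  (* An edge supplies the element of [S] that [enum_rank_in] requires, so the empty graph is treated
     apart. *)
  move=> dH; have [->|[e /imsetP[e1 _ _]]] := set_0Vmem (h H); first exact: is_dag0.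
  apply: (@hom_is_dag _ _ _ _ (fun x => enum_rank_in (enum_valP e1.1) x)) dH.
  move=> u v /imsetP[[i j] ij [-> ->]] /=.
  by rewrite /f !enum_valK_in.
rewrite (reindex_onto h h') /=; last by move=> G /andP[_]; apply: h'K.
apply: eq_big => [H|H _]; first by rewrite hK eqxx andbT hS andbT dh.
by rewrite /dag_weight card_imset.
Qed.

Hypotheses (p0 : 0 < p) (p1 : p < 1).
Let w := p / (1 - p).

Lemma weight_gt0 n (G : digraph n) : 0 < dag_weight _ p G.
Proof. by rewrite exprn_gt0 // divr_gt0 // subr_gt0. Qed.

Lemma dag_Z_gt0 n : 0 < dag_Z n p.
Proof.
rewrite /dag_Z (bigD1 finset.set0) ?is_dag0 //= ltr_wpDr ?weight_gt0 // sumr_ge0 // => G _.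
exact/ltW/weight_gt0.
Qed.

(** Edges between [T] and its complement only leave [T], so a cycle lies within one of the two
    sides. *)
Lemma is_dagU n (T : {set 'I_n}) (K B H : digraph n) :
  K \subset finset.setX T T -> B \subset finset.setX T (~: T) -> H \subset finset.setX (~: T) (~: T) ->
  is_dag K -> is_dag H -> is_dag (K :|: B :|: H).
Proof.
move=> /fintype.subsetP KT /fintype.subsetP BT /fintype.subsetP HT /is_dagP dK /is_dagP dH.
have inT u v : (u, v) \in K :|: B :|: H -> v \in T -> u \in T /\ (u, v) \in K.
  rewrite !inE -orbA => /or3P[] uv vT.
  - by have := KT _ uv; rewrite inE => /andP[].
  - by have := BT _ uv; rewrite !inE /= vT andbF.
  - by have := HT _ uv; rewrite !inE /= vT andbF.
have outT u v : (u, v) \in K :|: B :|: H -> u \notin T -> v \notin T /\ (u, v) \in H.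
  rewrite !inE -orbA => /or3P[] uv uT.
  - by have := KT _ uv; rewrite inE /= (negbTE uT).
  - by have := BT _ uv; rewrite !inE /= (negbTE uT).
  - by have := HT _ uv; rewrite !inE /= => /andP[].
apply/is_dagP => u v uv; apply/negP => vu.
have [vT|vT] := boolP (v \in T).
  have [uT uvK] := inT _ _ uv vT; have /negP := dK _ _ uvK; apply.
  have [] // := @connect_coinvariant _ _ (edge_rel K) (mem T) _ _ _ uT vu.
  by move=> x y yT xy; apply: inT.
have uT : u \notin T.
  have [] // := @connect_invariant _ _ (edge_rel H) [pred x | x \notin T] _ _ _ vT vu.
  by move=> x y yT xy; apply: outT.
have [_ uvH] := outT _ _ uv uT; have /negP := dH _ _ uvH; apply.
have [] // := @connect_invariant _ _ (edge_rel H) [pred x | x \notin T] _ _ _ vT vu.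
by move=> x y yT xy; apply: outT.
Qed.

(** Such a graph consists of [K], an arbitrary set of edges from [T] to its complement and a DAG on
    the complement, chosen independently; each accounts for one factor. *)
Lemma sum_inedges n (T : {set 'I_n}) (K : digraph n) :
  K \subset finset.setX T T -> is_dag K ->
  \sum_(G : digraph n | is_dag G && (inedges G T == K)) dag_weight _ p G =
  w ^+ #|K| * (1 + w) ^+ (#|T| * (n - #|T|)) * dag_Z (n - #|T|) p.
Proof.
move=> KT dK; set S := ~: T.
have -> : (n - #|T|)%N = #|S| by rewrite [RHS]cardsCs finset.setCK card_ord.
pose h (BH : digraph n * digraph n) := K :|: BH.1 :|: BH.2.
pose h' (G : digraph n) := (G :&: finset.setX T S, G :&: finset.setX S S).
have inT (G : digraph n) e : (e \in inedges G T) = (e \in G) && (e.2 \in T) by rewrite inE.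
rewrite (reindex_onto h h') /=; last first.
  move=> G /andP[_ /eqP GK]; apply/setP => -[x y].
  rewrite !inE -GK inT /=; case: (_ \in G) => //=.
  by case: (x \in T); case: (y \in T).
have KP e : e \in K -> (e.1 \in T) && (e.2 \in T).
  by move/(fintype.subsetP KT); rewrite inE.
rewrite (eq_bigl (fun BH : digraph n * digraph n =>
    (BH.1 \subset finset.setX T S) && (is_dag BH.2 && (BH.2 \subset finset.setX S S)))); last first.
  move=> [B H] /=; apply/idP/idP.
    move=> /andP[/andP[dh _] /eqP[EB EH]].
    apply/and3P; split; first by rewrite -EB finset.subsetIr.
      by apply: sub_is_dag dh; apply: finset.subsetUr.
    by rewrite -EH finset.subsetIr.
  move=> /and3P[BT dH HS]; rewrite (is_dagU KT BT HS dK dH) /=; apply/andP; split.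
    apply/eqP/setP => -[x y]; rewrite inT !inE /=.
    have [xyK|_] := boolP (_ \in K); first by have /andP[_ ->] := KP _ xyK.
    apply/negbTE/negP => /andP[/orP[/(fintype.subsetP BT)|/(fintype.subsetP HS)]].
      by rewrite !inE /= => /andP[_ /negbTE->].
    by rewrite !inE /= => /andP[_ /negbTE->].
  apply/eqP; congr (_, _); apply/setP => -[x y]; rewrite !inE /=.
    have := KP (x, y); have := fintype.subsetP BT (x, y); have := fintype.subsetP HS (x, y).
    rewrite !inE /=; case: (_ \in K); case: (_ \in B); case: (_ \in H);
    case: (x \in T); case: (y \in T) => //= H1 H2 H3; do ?[by have := H1 isT|by have := H2 isT|by have := H3 isT].
  have := KP (x, y); have := fintype.subsetP BT (x, y); have := fintype.subsetP HS (x, y).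
  rewrite !inE /=; case: (_ \in K); case: (_ \in B); case: (_ \in H);
  case: (x \in T); case: (y \in T) => //= H1 H2 H3; do ?[by have := H1 isT|by have := H2 isT|by have := H3 isT].
rewrite (eq_bigr (fun BH : digraph n * digraph n =>
   w ^+ #|K| * (w ^+ #|BH.1| * dag_weight _ p BH.2))); last first.
  move=> [B H] /= /and3P[BT dH HS]; rewrite /dag_weight -/w -!exprD addnA.
  congr (_ ^+ _); rewrite /h /= cardsU cardsU.
  have -> : K :&: B = finset.set0.
    apply/setP=> -[x y]; rewrite !inE; apply/negP => /andP[/KP/andP[_ /= yT]].
    by move/(fintype.subsetP BT); rewrite !inE /= yT andbF.
  have -> : (K :|: B) :&: H = finset.set0.
    apply/setP=> -[x y]; rewrite !inE; apply/negP => /andP[+ /(fintype.subsetP HS)].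
    rewrite !inE /= => /orP[/KP/andP[/= -> //]|/(fintype.subsetP BT)].
    by rewrite !inE /= => /andP[->].
  by rewrite !cards0 !subn0.
rewrite -mulr_sumr -mulrA; congr (_ * _).
rewrite -(pair_big (fun B : digraph _ => B \subset finset.setX T S) (fun H : digraph _ => is_dag H && (H \subset finset.setX S S))
   (fun B H : digraph _ => w ^+ #|B| * dag_weight _ p H)) /=.
rewrite -dag_Z_sub -cardsX -sum_subset_expr mulr_suml.
by apply: eq_bigr => B _; rewrite mulr_sumr.
Qed.

(** A DAG is determined by its restriction to all vertices but one and by its edges at that vertex,
    a subset of [2 * m] possible ones; all subsets are counted, hence only an inequality. *)
Lemma dag_Z_le m : dag_Z m.+1 p <= (1 + w) ^+ (2 * m) * dag_Z m p.
Proof.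
pose v : 'I_m.+1 := ord0; pose S := ~: [set v]; pose D := finset.setX [set v] S :|: finset.setX S [set v].
have cS : #|S| = m by rewrite cardsC1 card_ord.
have w0 : 0 <= w by rewrite divr_ge0 ?subr_ge0 // ltW.
have cD : #|D| = (2 * m)%N.
  rewrite /D cardsU !cardsX cards1 cS mul1n muln1.
  have -> : finset.setX [set v] S :&: finset.setX S [set v] = finset.set0.
    by apply/setP=> -[x y]; rewrite !inE /=; case: (x == v); rewrite ?andbF.
  by rewrite cards0 subn0 addnn mul2n.
pose h (BH : digraph m.+1 * digraph m.+1) := BH.1 :|: BH.2.
pose h' (G : digraph m.+1) := (G :&: D, G :&: finset.setX S S).
have -> : dag_Z m p = dag_Z #|S| p by rewrite cS.
rewrite [dag_Z m.+1 p]/dag_Z (reindex_onto h h') /=; last first.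
  move=> G /is_dagP dG; apply/setP => -[x y]; rewrite !inE /=.
  have [xy|//] := boolP (_ \in G).
  have /= := dG _ _ xy; have [->|xv] := eqVneq x v; have [->|yv] //= := eqVneq y v.
  by rewrite connect0.
rewrite -dag_Z_sub -cD -sum_subset_expr mulr_suml.
under [leRHS]eq_bigr do rewrite mulr_sumr.
rewrite (pair_big (fun B : digraph _ => B \subset D) (fun H : digraph _ => is_dag H && (H \subset finset.setX S S))
   (fun B H : digraph _ => w ^+ #|B| * dag_weight _ p H)) /=.
rewrite big_mkcond [leRHS]big_mkcond /=; apply: ler_sum => -[B H] _ /=.
case: ifPn => [/andP[dh /eqP[EB EH]]|_]; last first.
  by case: ifP => // _; rewrite mulr_ge0 ?exprn_ge0.
have BD : B \subset D by rewrite -EB finset.subsetIr.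
have HS : H \subset finset.setX S S by rewrite -EH finset.subsetIr.
have -> : is_dag H by apply: sub_is_dag dh; apply: finset.subsetUr.
rewrite BD HS /= /dag_weight -/w -exprD /h /= cardsU.
suff -> : B :&: H = finset.set0 by rewrite cards0 subn0.
apply/setP=> -[x y]; rewrite !inE; apply/negP => /andP[/(fintype.subsetP BD) + /(fintype.subsetP HS)].
rewrite !inE /= => + /andP[/negbTE xv /negbTE yv].
by rewrite xv yv.
Qed.
End DagSums.

(** * The mean number of sources *)

Lemma sum_by_card (R : pzRingType) n (F : nat -> R) :
  \sum_(T : {set 'I_n}) F #|T| = \sum_(k < n.+1) 'C(n, k)%:R * F k.
Proof.
rewrite (partition_big (fun T : {set 'I_n} => inord #|T| : 'I_n.+1) xpredT) //=.
apply: eq_bigr => k _.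
have cT (T : {set 'I_n}) : (inord #|T| == k) = (#|T| == k).
  by rewrite -val_eqE /= inordK // ltnS -[leqRHS]card_ord max_card.
rewrite (eq_bigr (fun=> F k)) => [|T]; last by rewrite cT => /eqP->.
rewrite (eq_bigl (fun T => T \in [set T : {set 'I_n} | #|T| == k])) => [|T]; last by rewrite cT inE.
by rewrite sumr_const card_draws card_ord mulr_natl.
Qed.

Lemma bin2D k m : 'C(k + m, 2) = ('C(k, 2) + 'C(m, 2) + k * m)%N.
Proof.
elim: k => [|k IHk]; first by rewrite bin0n mul0n addn0.
by rewrite addSn !(binS _ 1) !bin1 IHk; lia.
Qed.

Section Ratios.
Variables (R : realType) (p : R).
Hypotheses (p0 : 0 < p) (p1 : p < 1).
Let q := 1 - p.
Let w := p / (1 - p).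

Let q0 : 0 < q. Proof. by rewrite subr_gt0. Qed.
Let q1 : q < 1. Proof. by rewrite gtrBl. Qed.
Let w1E : 1 + w = q^-1.
Proof. by rewrite /w -/q; rewrite /q; field; rewrite gt_eqF. Qed.

Lemma dag_Z0 : dag_Z 0 p = 1.
Proof.
rewrite /dag_Z (big_pred1 finset.set0) => [|G]; first by rewrite /dag_weight cards0 expr0.
have -> : G = finset.set0 by apply/setP => -[[]].
by rewrite /= eqxx is_dag0.
Qed.

(* Robinson's recurrence: inclusion-exclusion over sets of sources, using that a
   nonempty DAG has a source. *)
Lemma dag_Z_recurrence n :
  \sum_(k < n.+1) 'C(n, k)%:R *
    ((-1) ^+ k * ((1 + w) ^+ (k * (n - k)) * dag_Z (n - k) p)) = (n == 0%N)%:R.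
Proof.
case: n => [|n]; first by rewrite big_ord1 /= bin0 mul0n !expr0 !mul1r dag_Z0.
rewrite -(sum_by_card _ (fun k => (-1) ^+ k * ((1 + w) ^+ (k * (n.+1 - k)) * dag_Z (n.+1 - k) p))).
transitivity (\sum_(T : {set 'I_n.+1}) \sum_(G : digraph n.+1 | is_dag G)
   (if inedges G T == finset.set0 then (-1) ^+ #|T| * dag_weight _ p G else 0)).
  apply: eq_bigr => T _; rewrite -big_mkcondr -mulr_sumr sum_inedges ?finset.sub0set ?is_dag0 //.
  by rewrite cards0 expr0 mul1r.
rewrite exchange_big /= big1 // => G dG.
pose src := [set v | [forall u, (u, v) \notin G]].
rewrite -big_mkcond (eq_bigl (fun T : {set 'I_n.+1} => T \subset src)) /=; last first.
  move=> T; apply/eqP/fintype.subsetP => [E v vT|Tsrc].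
    rewrite inE; apply/forallP => u; apply/negP => uv.
    by have := finset.in_set0 (u, v); rewrite -E inE uv vT.
  apply/setP => -[u v]; rewrite !inE /=; apply/negP => /andP[uv /Tsrc].
  by rewrite inE => /forallP/(_ u); rewrite uv.
(* The alternating sum over subsets of the source set is [(1 - 1) ^+ #|src|], zero as this set is
   nonempty. *)
rewrite -mulr_suml sum_subset_expr subrr; have [v vs] := dag_source (ltn0Sn n) dG.
rewrite (_ : 0 ^+ _ = 0) ?mul0r // expr0n cards_eq0.
case: eqP => // E; have : v \in src by rewrite inE; apply/forallP.
by rewrite E inE.
Qed.

(* Normalisation turning the recurrence into a convolution identity. *)
Definition dag_hat n : R := dag_Z n p * (1 - p) ^+ 'C(n, 2) / n`!%:R.

Lemma dag_hat_gt0 n : 0 < dag_hat n.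
Proof. by rewrite !mulr_gt0 ?exprn_gt0 ?invr_gt0 ?ltr0n ?fact_gt0 // dag_Z_gt0. Qed.

(** The splitting of ['C(n, 2)] over [k] and [n - k] lets the normalisation absorb the factor of the
    cross edges. *)
Lemma dag_hatE k n : (k <= n)%N ->
  (n ^_ k)%:R * ((1 + w) ^+ (k * (n - k)) * dag_Z (n - k) p) / dag_Z n p =
  q ^+ 'C(k, 2) * (dag_hat (n - k) / dag_hat n).
Proof.
move=> kn; have e : 'C(n, 2) = ('C(k, 2) + 'C(n - k, 2) + k * (n - k))%N.
  by rewrite -bin2D subnKC.
have nf : n`!%:R = (n ^_ k)%:R * (n - k)`!%:R :> R by rewrite -natrM ffact_fact.
rewrite /dag_hat -/q e nf w1E !exprD exprVn.
have Zn := dag_Z_gt0 p0 p1 n.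
field.
by rewrite !pnatr_eq0 -!lt0n ffact_gt0 kn fact_gt0 !expf_neq0 ?gt_eqF.
Qed.

Lemma dag_hat_reciprocal :
  reciprocal (fun k => (-1) ^+ k * q ^+ 'C(k, 2) / k`!%:R) dag_hat.
Proof.
move=> n; have := congr1 (fun x => x * dag_hat n / dag_Z n p) (dag_Z_recurrence n).
have -> : (n == 0%N)%:R * dag_hat n / dag_Z n p = (n == 0%N)%:R :> R.
  case: n => [|n]; last by rewrite !mul0r.
  by rewrite /dag_hat dag_Z0 bin0n fact0 expr0 !mulr1 !invr1 !mulr1.
move=> <-; rewrite /conv !mulr_suml; apply: eq_bigr => k _.
have kn := leq_ord k; have := dag_hatE kn.
rewrite -bin_ffact natrM -mulrA => /(congr1 (fun x => x * dag_hat n)).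
have [h0 Zn] := (dag_hat_gt0 n, dag_Z_gt0 p0 p1 n).
set z := (1 + w) ^+ _ * _; rewrite -[RHS]mulrA divfK ?gt_eqF // => E.
have -> : (-1) ^+ k * q ^+ 'C(k, 2) / k`!%:R * dag_hat (n - k) =
          (-1) ^+ k / k`!%:R * (q ^+ 'C(k, 2) * dag_hat (n - k)) by ring.
rewrite -E; field.
by rewrite pnatr_eq0 -lt0n fact_gt0 gt_eqF.
Qed.

Lemma dag_hat_log_concave : log_concave dag_hat.
Proof. exact: (reciprocal_log_concave q0 q1 dag_hat_reciprocal). Qed.

(* The expected number of sources of a random DAG on [n.+1] vertices. *)
Definition mean_sources n : R := dag_hat n / dag_hat n.+1.

Lemma mean_sources_gt0 n : 0 < mean_sources n.
Proof. by rewrite divr_gt0 ?dag_hat_gt0. Qed.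

(** For consecutive indices this is exactly the log-concavity of [dag_hat]. *)
Lemma mean_sources_mono m n : (m <= n)%N -> mean_sources m <= mean_sources n.
Proof.
elim: n => [|n IHn]; first by rewrite leqn0 => /eqP->.
rewrite leq_eqVlt => /orP[/eqP->//|/IHn/le_trans]; apply.
rewrite ler_pdivrMr ?dag_hat_gt0 // mulrAC ler_pdivlMr ?dag_hat_gt0 //.
by rewrite dag_hat_log_concave.
Qed.

(** By [dag_Z_le] one more vertex costs at most [(1 - p) ^- (2 * m)]; the normalisation returns
    [m.+1 / (1 - p) ^+ m]. *)
Lemma mean_sources_ge m : m.+1%:R * (1 - p) ^+ m <= mean_sources m.
Proof.
have Zle := dag_Z_le p0 p1 m; have [Z0 Z1] := (dag_Z_gt0 p0 p1 m, dag_Z_gt0 p0 p1 m.+1).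
rewrite -/q /mean_sources ler_pdivlMr ?dag_hat_gt0 // /dag_hat -/q.
rewrite (binS m 1) bin1 exprD factS natrM.
have f0 : 0 < m`!%:R :> R by rewrite ltr0n fact_gt0.
have -> : m.+1%:R * q ^+ m * (dag_Z m.+1 p * (q ^+ 'C(m, 2) * q ^+ m) / (m.+1%:R * m`!%:R)) =
   (q ^+ m * q ^+ m * dag_Z m.+1 p) * (q ^+ 'C(m, 2) / m`!%:R).
  by field; rewrite (gt_eqF f0) nat1r pnatr_eq0.
rewrite -[leRHS]mulrA ler_pM2r; last by rewrite divr_gt0 ?exprn_gt0.
rewrite mulrC -exprD -ler_pdivlMr ?exprn_gt0 //; apply: le_trans Zle _.
by rewrite -/w w1E exprVn mulrC addnn mul2n.
Qed.
End Ratios.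

(** * Moments of the number of private pairs *)

(** Joint events of two private pairs are again of the [inedges] form: on three vertices when the
    source is shared, on four otherwise, as [private_two] shows. *)
Lemma private_fork n (G : digraph n) u v v' :
  private_pair G u v -> private_pair G u v' -> v != v' ->
  uniq [:: u; v; v'] /\ inedges G [set x in [:: u; v; v']] == [set (u, v); (u, v')].
Proof.
move=> uv uv' vv'; have [/negbTE n1 _ _ _] := private_pairP uv; have [/negbTE n2 _ _ _] := private_pairP uv'.
split; first by rewrite /= !inE n1 n2 (negbTE vv').
move: uv uv' => /andP[_ /eqP E] /andP[_ /eqP E'].
by rewrite -E -E'; apply/eqP/setP=> e; rewrite !inE; case: (e \in G); case: (e.2 == u).
Qed.

Lemma private_two n (G : digraph n) u u' v v' :
  private_pair G u v -> private_pair G u' v' -> u != u' ->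
  uniq [:: u; u'; v; v'] /\
  inedges G [set x in [:: u; u'; v; v']] == [set (u, v); (u', v')].
Proof.
move=> uv uv' uu'.
have [n1 Gu su pu] := private_pairP uv; have [n2 Gu' su' pu'] := private_pairP uv'.
have n3 : u != v' by apply: contraTneq Gu' => <-; rewrite su.
have n4 : u' != v by apply: contraTneq Gu => <-; rewrite su'.
have n5 : v != v'.
  by apply/eqP => vv'; move: Gu'; rewrite -vv' => /pu e; rewrite e eqxx in uu'.
split; first by rewrite /= !inE (negbTE uu') (negbTE n1) (negbTE n2) (negbTE n3) (negbTE n4) (negbTE n5).
move: uv uv' => /andP[_ /eqP E] /andP[_ /eqP E'].
rewrite -E -E'; apply/eqP/setP=> e; rewrite !inE.
by case: (e \in G); case: (e.2 == u); case: (e.2 == u'); rewrite ?orbT.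
Qed.

Lemma sum_notin (R : pzRingType) n (s : seq 'I_n) (c : R) : uniq s ->
  \sum_(x | x \notin s) c = (n - size s)%:R * c.
Proof.
move=> us; rewrite sumr_const mulr_natl; congr (_ *+ _).
have /eqP := cardC (mem s); rewrite card_ord (card_uniqP us) => /eqP e.
transitivity (size s + #|[predC mem s]| - size s)%N; last by rewrite e.
by rewrite addKn; apply: eq_card => x; rewrite !inE.
Qed.

Lemma sum_uniq2 (R : pzRingType) n (c : R) :
  \sum_(u : 'I_n) \sum_(v | v \notin [:: u]) c = (n ^_ 2)%:R * c.
Proof.
rewrite (eq_bigr (fun=> (n - 1)%:R * c)) => [|u _]; last by rewrite sum_notin.
by rewrite sumr_const card_ord -[LHS]mulr_natl mulrA -natrM ffactnSr ffactn1.
Qed.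

Lemma sum_uniq3 (R : pzRingType) n (c : R) :
  \sum_(u : 'I_n) \sum_(v | v \notin [:: u]) \sum_(v' | v' \notin [:: u; v]) c =
  (n ^_ 3)%:R * c.
Proof.
transitivity (\sum_(u : 'I_n) \sum_(v | v \notin [:: u]) (n - 2)%:R * c).
  apply: eq_bigr => u _; apply: eq_bigr => v vu; rewrite sum_notin //.
  by move: vu; rewrite /= !inE eq_sym => ->.
by rewrite sum_uniq2 mulrA -natrM -ffactnSr.
Qed.

Lemma sum_uniq4 (R : pzRingType) n (c : R) :
  \sum_(u : 'I_n) \sum_(u' | u' \notin [:: u]) \sum_(v | v \notin [:: u; u'])
    \sum_(v' | v' \notin [:: u; u'; v]) c = (n ^_ 4)%:R * c.
Proof.
transitivity (\sum_(u : 'I_n) \sum_(u' | u' \notin [:: u])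
    \sum_(v | v \notin [:: u; u']) (n - 3)%:R * c).
  apply: eq_bigr => u _; apply: eq_bigr => u' u'u; apply: eq_bigr => v vu.
  rewrite sum_notin //; move: u'u vu; rewrite /= !inE !negb_or ![_ == u]eq_sym [v == u']eq_sym.
  by move=> -> /andP[-> ->].
by rewrite sum_uniq3 mulrA -natrM -ffactnSr.
Qed.

Section Expect.
Variables (R : realType) (p : R) (n : nat).
Hypotheses (p0 : 0 < p) (p1 : p < 1).
Implicit Types X Y : digraph n -> R.

Lemma dag_expect_le X Y : (forall G, is_dag G -> X G <= Y G) ->
  dag_expect n p X <= dag_expect n p Y.
Proof.
move=> XY; rewrite /dag_expect ler_pM2r ?invr_gt0 ?dag_Z_gt0 //.
by apply: ler_sum => G dG; rewrite ler_pM2l ?weight_gt0 // XY.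
Qed.

Lemma dag_expect1 : dag_expect n p (fun=> 1) = 1.
Proof.
rewrite /dag_expect; under eq_bigr do rewrite mulr1.
by rewrite -/(dag_Z n p) divff // gt_eqF // dag_Z_gt0.
Qed.

Lemma dag_expectD X Y :
  dag_expect n p (fun G => X G + Y G) = dag_expect n p X + dag_expect n p Y.
Proof.
by rewrite /dag_expect; under eq_bigr do rewrite mulrDr; rewrite big_split mulrDl.
Qed.

Lemma dag_expectZ c X : dag_expect n p (fun G => c * X G) = c * dag_expect n p X.
Proof.
rewrite /dag_expect; under eq_bigr do rewrite mulrCA.
by rewrite -mulr_sumr mulrA.
Qed.

Lemma dag_expect_sum (I : finType) (P : pred I) (F : I -> digraph n -> R) :
  dag_expect n p (fun G => \sum_(i | P i) F i G) = \sum_(i | P i) dag_expect n p (F i).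
Proof.
rewrite /dag_expect; under eq_bigr do rewrite mulr_sumr.
by rewrite exchange_big mulr_suml.
Qed.

Lemma dag_probE (A : pred (digraph n)) :
  dag_prob n p A = dag_expect n p (fun G => (A G)%:R).
Proof.
rewrite /dag_prob /dag_expect big_mkcondr; congr (_ / _); apply: eq_bigr => G _.
by case: (A G); rewrite ?mulr1 ?mulr0.
Qed.

(** The inverse falling factorial is written first because summing over all tuples of distinct
    vertices cancels it. *)
Lemma dag_expect_inedges (s : seq 'I_n) (K : digraph n) : uniq s ->
  K \subset finset.setX [set x in s] [set x in s] -> is_dag K ->
  dag_expect n p (fun G => (inedges G [set x in s] == K)%:R) =
  (n ^_ (size s))%:R^-1 *
  ((p / (1 - p)) ^+ #|K| * (1 - p) ^+ 'C(size s, 2) * (dag_hat p (n - size s) / dag_hat p n)).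
Proof.
move=> us KT dK; have cs : #|[set x in s]| = size s by rewrite cardsE; apply/card_uniqP.
have sn : (size s <= n)%N by rewrite -cs -[leqRHS]card_ord max_card.
have n0 : (n ^_ (size s))%:R != 0 :> R by rewrite pnatr_eq0 -lt0n ffact_gt0.
apply: (mulfI n0); rewrite mulVKf // -[RHS]mulrA -dag_hatE // /dag_expect.
under eq_bigr => G _.
  have -> : dag_weight n p G * (inedges G [set x in s] == K)%:R =
    if inedges G [set x in s] == K then dag_weight n p G else 0.
    by case: eqP; rewrite ?mulr1 ?mulr0.
  over.
rewrite -big_mkcondr sum_inedges // cs; ring.
Qed.

Definition out_private (G : digraph n) u : R := \sum_v (private_pair G u v)%:R.

Hypothesis n4 : (4 <= n)%N.
Let q0 : 1 - p != 0. Proof. by rewrite subr_eq0 gt_eqF. Qed.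

Let hat_gt0 k : 0 < dag_hat p k / dag_hat p n.
Proof. by rewrite divr_gt0 ?dag_hat_gt0. Qed.

Let ffact_neq0 k : (k <= 4)%N -> (n ^_ k)%:R != 0 :> R.
Proof. by move=> k4; rewrite pnatr_eq0 -lt0n ffact_gt0 (leq_trans k4). Qed.

Lemma dag_expect_private :
  dag_expect n p (fun G => \sum_u out_private G u) = p * (dag_hat p (n - 2) / dag_hat p n).
Proof.
rewrite dag_expect_sum.
transitivity (\sum_(u : 'I_n) \sum_(v | v \notin [:: u])
   (n ^_ 2)%:R^-1 * (p * (dag_hat p (n - 2) / dag_hat p n))).
  apply: eq_bigr => u _; rewrite dag_expect_sum [RHS]big_mkcond; apply: eq_bigr => v _ /=.
  rewrite inE; have [->|vu] := eqVneq v u.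
    rewrite /dag_expect big1 ?mul0r // => G _.
    by rewrite /private_pair eqxx mulr0.
  have us : uniq [:: u; v] by rewrite /= inE eq_sym vu.
  have := @dag_expect_inedges [:: u; v] [set (u, v)] us.
  have -> : [set x in [:: u; v]] = [set u; v] by apply/setP=> x; rewrite !inE.
  rewrite cards1 /= expr1 divfK // => <-.
  - congr dag_expect; apply/funext => G.
    by rewrite /private_pair eq_sym vu.
  - by rewrite finset.sub1set !inE !eqxx orbT.
  - apply: (@rank_is_dag _ _ (fun x => (x == v) : nat)) => x y; rewrite inE xpair_eqE.
    by move=> /andP[/eqP-> /eqP->]; rewrite eqxx eq_sym (negbTE vu).
by rewrite sum_uniq2 mulVKf // ffact_neq0.
Qed.

(** The diagonal [v = v'] reproduces the first moment. Forks have edge factor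
    [w^2 (1 - p)^3 = p^2 (1 - p)], at most [p^2], where [w = p / (1 - p)]. *)
Lemma dag_expect_sqr_private :
  dag_expect n p (fun G => \sum_u out_private G u ^+ 2) <=
  p * (dag_hat p (n - 2) / dag_hat p n) + p ^+ 2 * (dag_hat p (n - 3) / dag_hat p n).
Proof.
rewrite -dag_expect_private.
pose I3 u v v' (G : digraph n) : R :=
  (inedges G [set x in [:: u; v; v']] == [set (u, v); (u, v')])%:R.
apply: le_trans (_ : dag_expect n p (fun G => \sum_u out_private G u + \sum_u
    \sum_(v | v \notin [:: u]) \sum_(v' | v' \notin [:: u; v]) I3 u v v' G) <= _).
  apply: dag_expect_le => G dG; rewrite -big_split /=; apply: ler_sum => u _.
  rewrite expr2 {1}/out_private mulr_suml /out_private.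
  under [leLHS]eq_bigr do rewrite mulr_sumr.
  rewrite [X in _ + X]big_mkcond -big_split /=; apply: ler_sum => v _.
  rewrite (bigD1 v) //= -natrM mulnb andbb lerD2l.
  case: ifPn => [vu|]; last first.
    rewrite negbK inE => /eqP->; rewrite big1 // => v' _.
    by rewrite /private_pair eqxx mul0r.
  rewrite big_mkcond [leRHS]big_mkcond; apply: ler_sum => v' _.
  have [->|v'v] := eqVneq v' v; first by case: ifP => //; rewrite ler0n.
  have [uv|_] := boolP (private_pair G u v); last by rewrite mul0r; case: ifP; rewrite // ler0n.
  have [uv'|_] := boolP (private_pair G u v'); last by rewrite mulr0; case: ifP; rewrite // ler0n.
  have [|] := private_fork uv uv'; first by rewrite eq_sym.
  move=> /= /and3P[]; rewrite !inE !negb_or [u == v]eq_sym [u == v']eq_sym.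
  by move=> /andP[_ ->] _ _ E; rewrite v'v /I3 E mul1r.
rewrite dag_expectD lerD2l dag_expect_sum.
apply: le_trans (_ : \sum_(u : 'I_n) \sum_(v | v \notin [:: u]) \sum_(v' | v' \notin [:: u; v])
   (n ^_ 3)%:R^-1 * (p ^+ 2 * (dag_hat p (n - 3) / dag_hat p n)) <= _).
  apply: ler_sum => u _; rewrite dag_expect_sum; apply: ler_sum => v vu.
  rewrite dag_expect_sum; apply: ler_sum => v' v'uv.
  have us : uniq [:: u; v; v'].
    by move: vu v'uv; rewrite /= !inE !negb_or ![_ == u]eq_sym [v' == v]eq_sym => -> /andP[-> ->].
  rewrite dag_expect_inedges //.
  - rewrite ler_pM2l ?invr_gt0 ?lt0r ?ffact_neq0 ?ler0n //.
    rewrite (ler_pM2r (hat_gt0 _)) cards2.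
    have -> : ((u, v) != (u, v')) by rewrite xpair_eqE eqxx; move: us => /= /and3P[_]; rewrite inE.
    have -> : (p / (1 - p)) ^+ 2 * (1 - p) ^+ 'C(3, 2) = p ^+ 2 * (1 - p).
      by rewrite (_ : 'C(3, 2) = 3%N) //; field.
    by rewrite ger_pMr ?exprn_gt0 // gerBl ltW.
  - by apply/fintype.subsetP => e; rewrite !inE => /orP[]/eqP->; rewrite /= !eqxx ?orbT.
  - apply: (@rank_is_dag _ _ (fun x => (x != u) : nat)) => x y; move: us => /=.
    rewrite !inE !negb_or !xpair_eqE => /and3P[/andP[uv uv'] _ _].
    by move=> /orP[]/andP[/eqP-> /eqP->]; rewrite eqxx eq_sym ?uv ?uv'.
by rewrite sum_uniq3 mulVKf // ffact_neq0.
Qed.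

(** Equal sources give the first term; two disjoint pairs have edge factor [p^2 (1 - p)^4], at most
    [p^2]. *)
Lemma dag_expect_private_sqr :
  dag_expect n p (fun G => (\sum_u out_private G u) ^+ 2) <=
  dag_expect n p (fun G => \sum_u out_private G u ^+ 2) +
  p ^+ 2 * (dag_hat p (n - 4) / dag_hat p n).
Proof.
pose I4 u u' v v' (G : digraph n) : R :=
  (inedges G [set x in [:: u; u'; v; v']] == [set (u, v); (u', v')])%:R.
apply: le_trans (_ : dag_expect n p (fun G => \sum_u out_private G u ^+ 2 + \sum_u
    \sum_(u' | u' \notin [:: u]) \sum_(v | v \notin [:: u; u'])
    \sum_(v' | v' \notin [:: u; u'; v]) I4 u u' v v' G) <= _).
  apply: dag_expect_le => G dG; rewrite -big_split /= expr2 mulr_suml; apply: ler_sum => u _.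
  rewrite mulr_sumr (bigD1 u) //= -expr2 lerD2l.
  rewrite big_mkcond [leRHS]big_mkcond; apply: ler_sum => u' _ /=; rewrite inE.
  case: ifPn => // u'u; rewrite /out_private mulr_suml.
  under [leLHS]eq_bigr do rewrite mulr_sumr.
  have -> : \sum_(v | v \notin [:: u; u']) \sum_(v' | v' \notin [:: u; u'; v]) I4 u u' v v' G =
      \sum_v \sum_v' (if (v \notin [:: u; u']) && (v' \notin [:: u; u'; v]) then I4 u u' v v' G else 0).
    rewrite big_mkcond; apply: eq_bigr => v _; case: ifP => _; last by rewrite big1.
    by rewrite big_mkcond.
  apply: ler_sum => v _; apply: ler_sum => v' _.
  have [uv|_] := boolP (private_pair G u v); last by rewrite mul0r; case: ifP; rewrite // ler0n.
  have [uv'|_] := boolP (private_pair G u' v'); last by rewrite mulr0; case: ifP; rewrite // ler0n.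
  have [|us E] := private_two uv uv'; first by rewrite eq_sym.
  suff -> : (v \notin [:: u; u']) && (v' \notin [:: u; u'; v]) by rewrite mul1r /I4 E.
  move: us; rewrite /= !inE !negb_or ![v == _]eq_sym ![v' == _]eq_sym.
  by move=> /and4P[/and3P[_ -> ->] /andP[-> ->] -> _].
rewrite dag_expectD lerD2l dag_expect_sum.
apply: le_trans (_ : \sum_(u : 'I_n) \sum_(u' | u' \notin [:: u]) \sum_(v | v \notin [:: u; u'])
   \sum_(v' | v' \notin [:: u; u'; v])
   (n ^_ 4)%:R^-1 * (p ^+ 2 * (dag_hat p (n - 4) / dag_hat p n)) <= _).
  apply: ler_sum => u _; rewrite dag_expect_sum; apply: ler_sum => u' u'u.
  rewrite dag_expect_sum; apply: ler_sum => v vu; rewrite dag_expect_sum; apply: ler_sum => v' v'u.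
  have us : uniq [:: u; u'; v; v'].
    move: u'u vu v'u; rewrite /= !inE !negb_or ![_ == u]eq_sym [v == u']eq_sym [v' == u']eq_sym [v' == v]eq_sym.
    by move=> -> /andP[-> ->] /and3P[-> -> ->].
  have := us; rewrite /= !inE !negb_or => /and4P[/and3P[n1 n2 n3] /andP[n5 n6] n7 _].
  rewrite dag_expect_inedges //.
  - rewrite ler_pM2l ?invr_gt0 ?lt0r ?ffact_neq0 ?ler0n //.
    rewrite (ler_pM2r (hat_gt0 _)) cards2.
    have -> : (u, v) != (u', v') by rewrite xpair_eqE (negbTE n1).
    have -> : (p / (1 - p)) ^+ 2 * (1 - p) ^+ 'C(4, 2) = p ^+ 2 * (1 - p) ^+ 4.
      by rewrite (_ : 'C(4, 2) = 6%N) //; field.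
    by rewrite ger_pMr ?exprn_gt0 // exprn_ile1 // ?subr_ge0 ?gerBl ltW.
  - by apply/fintype.subsetP => e; rewrite !inE => /orP[]/eqP->; rewrite /= !eqxx ?orbT.
  - apply: (@rank_is_dag _ _ (fun x => (x \in [:: v; v']) : nat)) => x y.
    rewrite !inE !xpair_eqE.
    move=> /orP[]/andP[/eqP-> /eqP->]; rewrite eqxx ?orbT.
      by rewrite (negbTE n2) (negbTE n3).
    by rewrite (negbTE n5) (negbTE n6).
by rewrite sum_uniq4 mulVKf // ffact_neq0.
Qed.
End Expect.

(** * Concentration *)

Lemma bernoulli_ineq (R : realFieldType) (x : R) k : 0 <= x <= 1 -> 1 - k%:R * x <= (1 - x) ^+ k.
Proof.
move=> /andP[x0 x1]; elim: k => [|k IHk]; first by rewrite mul0r subr0.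
rewrite exprS; apply: le_trans (_ : (1 - x) * (1 - k%:R * x) <= _).
  rewrite -natr1; have : 0 <= k%:R * x ^+ 2 by rewrite mulr_ge0 ?ler0n // sqr_ge0.
  by lra.
by rewrite ler_wpM2l // subr_ge0.
Qed.

Definition private_sources n (G : digraph n) := #|[set u | [exists v, private_pair G u v]]|.

Section Concentration.
Variables (R : realType) (p : R).
Hypotheses (p0 : 0 < p) (p1 : p < 1).

(** By monotonicity it suffices to take [k] the integer part of [1 / (2 p)]: there
    [(1 - p) ^+ k >= 1/2] by Bernoulli, and [p * k.+1 >= 1/2]. *)
Lemma mean_sources_ge_quarter n : (2 * p)^-1 <= n%:R -> 4^-1 <= p * mean_sources p n.
Proof.
move=> pn; set x := (2 * p)^-1; have x0 : 0 <= x by rewrite invr_ge0 mulr_ge0 // ltW.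
have /andP[kx xk] := truncn_itv x0; set k := Num.truncn x in kx xk.
have kn : (k <= n)%N by rewrite -(ler_nat R) (le_trans kx).
apply: le_trans (_ : p * mean_sources p k <= _); last first.
  by rewrite ler_pM2l // mean_sources_mono.
apply: le_trans (_ : p * (k.+1%:R * (1 - p) ^+ k) <= _); last first.
  by rewrite ler_pM2l // mean_sources_ge.
have xp : x * p = 2^-1 by rewrite /x; field; rewrite gt_eqF.
have h1 : 2^-1 <= (1 - p) ^+ k.
  apply: le_trans (bernoulli_ineq k _); last by rewrite !ltW.
  by have : k%:R * p <= x * p by [rewrite ler_pM2r]; lra.
have h2 : 2^-1 <= p * k.+1%:R by rewrite -xp mulrC ler_pM2l // ltW.
rewrite mulrA; apply: le_trans (_ : 2^-1 * 2^-1 <= _); first by lra.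
by rewrite ler_pM // invr_ge0.
Qed.

(* [2 t x - t^2 x^2 <= 1], applied to the number [x] of private children of each source. *)
Lemma private_sources_ge n (G : digraph n) (t : R) :
  2 * t * (\sum_u out_private R G u) - t ^+ 2 * (\sum_u out_private R G u ^+ 2) <=
  (private_sources G)%:R.
Proof.
rewrite !mulr_sumr -sumrB /private_sources -sum1_card natr_sum [leRHS]big_mkcond /=.
apply: ler_sum => u _; rewrite inE; case: ifPn => [_|].
  by have := sqr_ge0 (1 - t * out_private R G u); rewrite sqrrB expr1n mul1r exprMn; lra.
rewrite negb_exists => /forallP nu; rewrite /out_private big1; first by rewrite expr0n !mulr0 subr0.
by move=> v _; rewrite (negbTE (nu v)).
Qed.

(** Chebyshev keeps the number [X] of private pairs above half its mean [M], Markov keeps the sum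
    [S] of squares below [om * V]; then [private_sources_ge] applies. Here [V = M (1 + p L)] bounds
    both the variance of [X] and the mean of [S]. *)
Lemma private_sources_whp n (om : R) : (4 <= n)%N -> (2 * p)^-1 <= (n - 2)%:R -> 0 < om ->
  1 - 128 * p - om^-1 <=
  dag_prob n p (fun G => (128 * om * p)^-1 <= (private_sources G)%:R :> R).
Proof.
move=> n4 pn om0; rewrite dag_probE.
have [m nE] : exists m, n = m.+4 by exists (n - 4)%N; lia.
have r0 k : 0 < mean_sources p k := mean_sources_gt0 p0 p1 k.
have hne k : dag_hat p k != 0 by rewrite gt_eqF // dag_hat_gt0.
pose L := mean_sources p m.+2; pose U := mean_sources p m.+3.
have L4 : 4^-1 <= p * L by apply: mean_sources_ge_quarter; move: pn; rewrite nE.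
have [rm1 rm] : mean_sources p m.+1 <= L /\ mean_sources p m <= L.
  by split; apply: mean_sources_mono => //; rewrite ltnW.
have LU : L <= U by apply: mean_sources_mono.
have [L0 U0] : 0 < L /\ 0 < U by split; apply: r0.
have LU0 : 0 < L * U by apply: mulr_gt0.
pose X (G : digraph n) := \sum_u out_private R G u.
pose S (G : digraph n) := \sum_u out_private R G u ^+ 2.
pose M := p * (L * U); have M0 : 0 < M by rewrite /M mulr_gt0 // mulr_gt0.
have pL0 : 0 < 1 + p * L by rewrite addr_gt0 // mulr_gt0.
have EX : dag_expect n p X = M.
  rewrite dag_expect_private // nE; congr (_ * _); rewrite /L /U /mean_sources.
  by rewrite !subSS subn0; field; rewrite !hne.
have ES : dag_expect n p S <= M * (1 + p * L).
  apply: le_trans (dag_expect_sqr_private p0 p1 n4) _.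
  rewrite -dag_expect_private // -/X EX mulrDr mulr1 lerD2l.
  have -> : dag_hat p (n - 3) / dag_hat p n = mean_sources p m.+1 * (L * U).
    by rewrite nE /L /U /mean_sources !subSS subn0; field; rewrite !hne.
  rewrite /M; have -> : p * (L * U) * (p * L) = p ^+ 2 * (L * (L * U)) by ring.
  by rewrite ler_pM2l ?exprn_gt0 // (ler_pM2r LU0).
have EX2 : dag_expect n p (fun G => X G ^+ 2) <= M * (1 + p * L) + M ^+ 2.
  apply: le_trans (dag_expect_private_sqr p0 p1 n4) _; apply: lerD => //.
  have -> : dag_hat p (n - 4) / dag_hat p n = (mean_sources p m * mean_sources p m.+1) * (L * U).
    by rewrite nE /L /U /mean_sources !subSS subn0; field; rewrite !hne.
  rewrite /M exprMn ler_pM2l ?exprn_gt0 // expr2 (ler_pM2r LU0).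
  by apply: ler_pM; rewrite ?(ltW (r0 _)) // (le_trans rm1).
clearbody L U.
(* Since [p U >= 1/4], [32 p M >= 8 p L], and this is at least [1 + p L] because [p L >= 1/4]. *)
have MpL : (32 * p)^-1 <= M / (1 + p * L).
  rewrite ler_pdivlMr // mulrC ler_pdivrMr ?mulr_gt0 //.
  have U4 : 4^-1 <= U * p by rewrite mulrC (le_trans L4) // ler_pM2l.
  have -> : M * (32 * p) = 32 * (p * L) * (U * p) by rewrite /M; ring.
  apply: le_trans (_ : 32 * (p * L) * 4^-1 <= _); first by lra.
  by rewrite ler_pM2l // mulr_gt0 // mulr_gt0.
pose V := M * (1 + p * L); have V0 : 0 < V by rewrite /V mulr_gt0.
(* [Y] is [1 - 4 (X - M)^2 / M^2 - S / (om V)], a pointwise lower bound for the indicator; it merges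
   Chebyshev and Markov into one expectation. *)
pose Y (G : digraph n) : R :=
  1 + - (4 / M ^+ 2) * (X G ^+ 2 + (- (2 * M) * X G + M ^+ 2 * 1)) + - (om * V)^-1 * S G.
apply: le_trans (_ : dag_expect n p Y <= _).
  rewrite /Y 2!dag_expectD !dag_expectZ 2!dag_expectD !dag_expectZ dag_expect1 // EX.
  rewrite -[leLHS]addrA -[leRHS]addrA lerD2l; apply: lerD.
    rewrite mulNr lerN2; apply: le_trans (_ : 4 / M ^+ 2 * V <= _).
      rewrite ler_pM2l ?divr_gt0 ?exprn_gt0 //; apply: le_trans (lerD EX2 (lexx _)) _.
      by rewrite -/V le_eqVlt; apply/orP; left; apply/eqP; ring.
    have -> : 4 / M ^+ 2 * V = 4 / (M / (1 + p * L)).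
      by rewrite /V; field; rewrite !gt_eqF.
    rewrite ler_pdivrMr ?divr_gt0 //.
    apply: le_trans (_ : 128 * p * (32 * p)^-1 <= _); last by rewrite ler_pM2l // mulr_gt0.
    rewrite le_eqVlt; apply/orP; left; apply/eqP; field; by rewrite gt_eqF.
  rewrite mulNr lerN2 ler_pdivrMl ?mulr_gt0 //.
  by rewrite mulrAC divff ?mul1r // gt_eqF.
apply: (dag_expect_le p0 p1) => G dG; rewrite /Y mulr1.
have -> : X G ^+ 2 + (- (2 * M) * X G + M ^+ 2) = (X G - M) ^+ 2 by ring.
have S0 : 0 <= S G by apply: sumr_ge0 => u _; apply: sqr_ge0.
have a0 : 0 <= 4 / M ^+ 2 * (X G - M) ^+ 2.
  by rewrite mulr_ge0 ?sqr_ge0 // divr_ge0 // sqr_ge0.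
have b0 : 0 <= (om * V)^-1 * S G by rewrite mulr_ge0 // invr_ge0 mulr_ge0 // ltW.
have c0 : 0 <= ((128 * om * p)^-1 <= (private_sources G)%:R :> R)%:R :> R by rewrite ler0n.
have [XM|MX] := leP (X G) (M / 2).
  have : 1 <= 4 / M ^+ 2 * (X G - M) ^+ 2.
    rewrite mulrAC ler_pdivlMr ?exprn_gt0 // mul1r.
    have : 0 <= (M - 2 * X G) * (3 * M - 2 * X G) by rewrite mulr_ge0; lra.
    by lra.
  by lra.
have [VS|SV] := leP (om * V) (S G).
  have : 1 <= (om * V)^-1 * S G by rewrite ler_pdivlMl ?mulr1 // mulr_gt0.
  by lra.
have -> : (128 * om * p)^-1 <= (private_sources G)%:R :> R; last by rewrite mulr1n; lra.
(* The maximiser of [2 t x - t^2 s] at [x = M / 2] and [s = om * V]. *)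
pose t := (2 * om * (1 + p * L))^-1.
have t0 : 0 < t by rewrite invr_gt0 !mulr_gt0.
apply: le_trans (private_sources_ge G t); rewrite -/(X G) -/(S G).
apply: le_trans (_ : 2 * t * (M / 2) - t ^+ 2 * (om * V) <= _).
  have -> : 2 * t * (M / 2) - t ^+ 2 * (om * V) = (M / (1 + p * L)) / (4 * om).
    by rewrite /t /V; field; rewrite !gt_eqF.
  rewrite ler_pdivlMr ?mulr_gt0 //; apply: le_trans MpL.
  by rewrite le_eqVlt; apply/orP; left; apply/eqP; field; rewrite !gt_eqF.
apply: lerB; first by rewrite ler_pM2l ?ltW // mulr_gt0.
by rewrite ler_pM2l ?exprn_gt0 // ltW.
Qed.
End Concentration.

(** * From private sources to the size of the class *)

Section MECBound.
Variables (R : realType) (p : R).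
Hypotheses (p0 : 0 < p) (p1 : p < 1).

Let ln_gt0 : 0 < ln p^-1.
Proof. by apply: ln_gt0; rewrite invf_gt1. Qed.

Lemma mec_bound_ge1 (c : R) : 0 <= c -> 1 <= mec_bound c p.
Proof.
move=> c0; rewrite -(powRr0 2) /mec_bound ler_powR ?ler1n //.
by rewrite !mulr_ge0 ?invr_ge0 ?sqr_ge0 // ltW.
Qed.

Lemma mec_bound_mono (c d : R) : c <= d -> mec_bound c p <= mec_bound d p.
Proof.
move=> cd; rewrite /mec_bound ler_powR ?ler1n // -!mulrA ler_wpM2r //.
by rewrite mulr_ge0 ?invr_ge0 ?sqr_ge0 // ltW.
Qed.

Lemma mec_bound_sqr (c : R) : mec_bound (2 * c) p = mec_bound c p ^+ 2.
Proof.
rewrite /mec_bound [RHS]expr2 -powRD; last by rewrite pnatr_eq0 implybT.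
by congr (_ `^ _); ring.
Qed.

Lemma mec_bound_le_card n (G : digraph n) (c : R) : is_dag G ->
  c * p^-1 / ln p^-1 ^+ 2 <= (private_sources G)%:R -> mec_bound c p <= #|MEC G|%:R.
Proof.
move=> dG cG; apply: le_trans (_ : 2 `^ (private_sources G)%:R <= _).
  by rewrite /mec_bound ler_powR ?ler1n.
by rewrite powR_mulrn // -natrX ler_nat leq_card_MEC.
Qed.

Lemma dag_prob_le1 n (A : pred (digraph n)) : dag_prob n p A <= 1.
Proof.
rewrite dag_probE -[leRHS](dag_expect1 n p0 p1); apply: (dag_expect_le p0 p1) => G _.
by case: (A G).
Qed.

(** The deviation parameter is taken to be [ln p^-1 ^+ 2]: this is the source of the squared
    logarithm in the exponent, and its inverse is the Markov error. *)
Lemma dag_prob_mec_ge n : (4 <= n)%N -> (2 * p)^-1 <= (n - 2)%:R ->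
  1 - 128 * p - (ln p^-1 ^+ 2)^-1 <=
  dag_prob n p (fun G => mec_bound 128^-1 p <= #|MEC G|%:R).
Proof.
move=> n4 pn; have om0 : 0 < ln p^-1 ^+ 2 by rewrite exprn_gt0.
apply: le_trans (private_sources_whp p0 p1 n4 pn om0) _.
rewrite !dag_probE; apply: (dag_expect_le p0 p1) => G dG.
case: (boolP (_ <= (private_sources G)%:R)) => [h|_]; last by rewrite ler0n.
rewrite (mec_bound_le_card dG) //; apply: le_trans h.
by rewrite !invfM mulrAC lexx.
Qed.

(* Since [#|MEC G| >= 1], AM-GM gives [E >= 1 - P + P a^2 >= (1 + a^2) / 2 >= a]
   with [a] the weaker bound, as soon as [P >= 1/2]. *)
Lemma dag_expect_mec_ge n (c : R) : 0 <= c ->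
  2^-1 <= dag_prob n p (fun G => mec_bound (2 * c) p <= #|MEC G|%:R) ->
  mec_bound c p <= dag_expect n p (fun G => #|MEC G|%:R).
Proof.
move=> c0; rewrite dag_probE mec_bound_sqr; have := mec_bound_ge1 c0.
set a := mec_bound c p => a1; set P := dag_expect _ _ _ => P2.
apply: le_trans (_ : 1 + (a ^+ 2 - 1) * P <= _).
  apply: le_trans (_ : 1 + (a ^+ 2 - 1) * 2^-1 <= _).
    by have := sqr_ge0 (a - 1); lra.
  by rewrite lerD2l ler_wpM2l // subr_ge0 exprn_ege1.
rewrite -{1}(dag_expect1 n p0 p1) -dag_expectZ -dag_expectD.
apply: (dag_expect_le p0 p1) => G dG.
case: (boolP (a ^+ 2 <= _)) => [h|_]; first by rewrite mulr1 addrC subrK.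
rewrite /= mulr0 addr0 ler1n (leq_trans _ (leq_card_MEC dG)) //.
by rewrite expn_gt0.
Qed.
End MECBound.

(** * Asymptotics of the edge probability *)

Section Limits.
Variable R : realType.
Local Open Scope classical_set_scope.
Local Open Scope ring_scope.

(** From [n = 2] on, [p n] is squeezed between 0 and [p n * ln n / ln 2]. *)
Lemma cvg0_of_mul_ln (p : nat -> R) : (\forall n \near \oo, 0 < p n) ->
  (fun n => p n * ln n%:R) @ \oo --> (0 : R) -> p @ \oo --> (0 : R).
Proof.
move=> p0 pln; have l2 : 0 < ln 2 :> R by apply: ln_gt0; rewrite ltr1n.
have cM : (fun n => p n * ln n%:R * (ln 2)^-1) @ \oo --> (0 : R).
  by rewrite -(mul0r (ln 2)^-1); apply: cvgM => //; apply: cvg_cst.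
apply: squeeze_cvgr (@cvg_cst _ (0 : R) _ _ _) cM.
near=> n; have pn : 0 < p n by near: n.
rewrite ltW //= ler_pdivlMr // ler_pM2l // ler_ln ?posrE ?ltr0n //.
  by rewrite ler_nat; near: n; exists 2%N.
by near: n; exists 1%N.
Unshelve. all: by end_near. Qed.

Lemma cvg_ln_inv_sqr (p : nat -> R) : (\forall n \near \oo, 0 < p n) ->
  p @ \oo --> (0 : R) -> (fun n => (ln (p n)^-1 ^+ 2)^-1) @ \oo --> (0 : R).
Proof.
move=> p0 pc.
have lny : (fun n => ln (p n)^-1) @ \oo --> +oo.
  apply/cvgryPge => A; near=> n; have pn : 0 < p n by near: n.
  rewrite -[A]expRK ler_ln ?posrE ?expR_gt0 ?invr_gt0 //.
  rewrite -[leLHS]invrK lef_pV2 ?posrE ?invr_gt0 ?expR_gt0 //.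
  apply/ltW; near: n; apply: (cvgr_lt _ pc); by rewrite invr_gt0 expR_gt0.
have l0 : \forall n \near \oo, 0 < ln (p n)^-1.
  have /cvgryPgt/(_ 0) := lny; exact.
have /(gtr0_cvgV0 l0) li := lny.
have -> : (fun n => (ln (p n)^-1 ^+ 2)^-1) = (fun n => (ln (p n)^-1)^-1 * (ln (p n)^-1)^-1).
  by apply/funext => n; rewrite expr2 invfM.
by rewrite -(mulr0 (0 : R)); apply: cvgM.
Unshelve. all: by end_near. Qed.
End Limits.

Local Open Scope classical_set_scope.
Local Open Scope ring_scope.

Theorem theorem1 (R : realType) :
  exists c : R, 0 < c /\
  forall p : nat -> R,
    (forall n : nat, (7 <= n)%N -> 6 / n%:R <= p n /\ p n < 1) ->
    (fun n : nat => p n * ln (n%:R : R)) @ \oo --> (0 : R) ->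
    (fun n : nat =>
       dag_prob n (p n) (fun G => mec_bound c (p n) <= (#|MEC G|)%:R))
      @ \oo --> (1 : R)
    /\ (\forall n \near (\oo : set_system nat),
          mec_bound c (p n) <= dag_expect n (p n) (fun G => (#|MEC G|)%:R)).
Proof.
(* Half of the constant [128^-1] of the high-probability bound, since passing to the expectation
   costs a factor 2 in the exponent. *)
exists 256^-1; split=> [|p p67 pln]; first by rewrite invr_gt0.
have n7 : \forall n \near \oo, (7 <= n)%N by exists 7%N.
have pP n : (7 <= n)%N -> 0 < p n /\ p n < 1.
  move=> n7'; have [pn p1] := p67 n n7'; split=> //; apply: lt_le_trans pn.
  by rewrite divr_gt0 // ltr0n; lia.
have p0 : \forall n \near \oo, 0 < p n by apply: filterS n7 => n /pP[].
have pc := cvg0_of_mul_ln p0 pln.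
pose lo n := 1 - 128 * p n - (ln (p n)^-1 ^+ 2)^-1.
have loc : lo @ \oo --> (1 : R).
  have -> : (1 : R) = 1 - 128 * 0 - 0 by rewrite mulr0 !subr0.
  apply: cvgB (cvg_ln_inv_sqr p0 pc); apply: cvgB; first exact: cvg_cst.
  by apply: cvgM => //; apply: cvg_cst.
have loP n : (7 <= n)%N ->
    lo n <= dag_prob n (p n) (fun G => mec_bound 128^-1 (p n) <= (#|MEC G|)%:R).
  move=> n7'; have [pn0 pn1] := pP n n7'; have [pn _] := p67 n n7'.
  apply: dag_prob_mec_ge => //; first by lia.
  have n0 : 0 < n%:R :> R by rewrite ltr0n; lia.
  have n6 : 6 <= p n * n%:R by rewrite -ler_pdivrMr.
  (* With [p n * n >= 6] this yields [p n * (n - 2) >= 2], more than the required 1/2. *)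
  have n2 : n%:R <= 3 * (n - 2)%:R :> R by rewrite -natrM ler_nat; lia.
  rewrite -[leLHS]mul1r ler_pdivrMr ?mulr_gt0 //.
  have : p n * n%:R <= p n * (3 * (n - 2)%:R) by rewrite ler_pM2l.
  by lra.
have loP' n : (7 <= n)%N ->
    lo n <= dag_prob n (p n) (fun G => mec_bound 256^-1 (p n) <= (#|MEC G|)%:R).
  move=> n7'; apply: le_trans (loP n n7') _; have [pn0 pn1] := pP n n7'.
  rewrite !dag_probE; apply: (dag_expect_le pn0 pn1) => G _.
  case: (boolP (_ <= #|MEC G|%:R)) => [h|_]; last by rewrite ler0n.
  rewrite (le_trans _ h) // mec_bound_mono //; lra.
split.
  apply: squeeze_cvgr loc (@cvg_cst _ (1 : R) _ _ _).
  near=> n; have n7' : (7 <= n)%N by near: n.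
  by have [pn0 pn1] := pP n n7'; rewrite loP' // dag_prob_le1.
have lo2 : \forall n \near \oo, 2^-1 < lo n by apply: (cvgr_gt _ loc); lra.
near=> n; have n7' : (7 <= n)%N by near: n.
have [pn0 pn1] := pP n n7'; apply: dag_expect_mec_ge => //.
rewrite (_ : 2 * 256^-1 = 128^-1); last by lra.
by apply: le_trans (loP n n7'); apply/ltW; near: n.
Unshelve. all: by end_near.
Qed.
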